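(* There is a polynomial-time algorithm that, given $n$ points in the plane and a positive integer $k\le n$, constructs a rectilinear tree spanning at least $k$ of these points such that the total length of the tree is at most $O(k^{1/4})$ times that of a minimum-length rectilinear tree spanning any $k$ of the points.
   Context: A rectilinear tree spanning a subset of the points is a spanning tree on the points of the subset in which the length of an edge is the rectilinear ($L_1$) distance between its endpoints; the length of the tree is the sum of its edge lengths. The minimum is over all choices of $k$ of the points and all rectilinear trees spanning them. The constant hidden in $O(\cdot)$ is absolute. *)

(* Defs.v *)
From mathcomp Require Import all_boot all_order all_algebra.
From mathcomp Require Import reals exp.

Set Implicit Arguments.
Unset Strict Implicit.
Unset Printing Implicit Defensive.

Import Order.TTheory GRing.Theory Num.Theory.
Local Open Scope ring_scope.

Definition l1_dist (R : realType) (p q : R * R) : R :=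
  `|p.1 - q.1| + `|p.2 - q.2|.

(* A graph is given by its vertex set [S] and its set [E] of edges, an edge
   being a set of two vertices. *)
Definition adjacent (T : finType) (E : {set {set T}}) : rel T :=
  fun u v => [set u; v] \in E.

Definition is_graph (T : finType) (S : {set T}) (E : {set {set T}}) : Prop :=
  forall e, e \in E -> e \subset S /\ #|e| = 2%N.

Definition is_connected (T : finType) (S : {set T}) (E : {set {set T}}) : Prop :=
  {in S &, forall u v, connect (adjacent E) u v}.

Definition is_acyclic (T : finType) (E : {set {set T}}) : Prop :=
  forall c : seq T, (2 < size c)%N -> uniq c -> ~~ cycle (adjacent E) c.

Definition is_tree (T : finType) (S : {set T}) (E : {set {set T}}) : Prop :=
  [/\ S != set0, is_graph S E, is_connected S E & is_acyclic E].

(* The condition [u < v] makes every edge count once. *)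
Definition rect_length (R : realType) (n : nat) (P : 'I_n -> R * R)
    (E : {set {set 'I_n}}) : R :=
  \sum_(u : 'I_n) \sum_(v : 'I_n | (u < v)%N && adjacent E u v)
    l1_dist (P u) (P v).

Definition min_rect_k_tree (R : realType) (n : nat) (P : 'I_n -> R * R)
    (k : nat) (S : {set 'I_n}) (E : {set {set 'I_n}}) : Prop :=
  [/\ is_tree S E, #|S| = k &
      forall (S' : {set 'I_n}) (E' : {set {set 'I_n}}),
        is_tree S' E' -> #|S'| = k -> rect_length P E <= rect_length P E'].

(* A real RAM.  The memory consists of unbounded arrays of natural numbers and unbounded
    arrays of reals, all cells being initially 0 except for the input.  A
    program names finitely many arrays, so this is the usual random access
    memory up to interleaving.

    The only arithmetic is addition and subtraction (truncated on naturals):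
    a unit-cost multiplication would create numbers of 2^t bits in O(t) steps.
    Here a computation of t steps on rational data only handles numbers whose
    bit length is polynomial in t and the bit length of the data, so that
    polynomially many steps are also polynomial time on a Turing machine. *)

Inductive nat_expr : Type :=
| NConst of nat
| NGet of nat & nat_expr          (* NGet a e : cell e of natural array a *)
| NAdd of nat_expr & nat_expr
| NSub of nat_expr & nat_expr.

Inductive real_expr : Type :=
| RConst of nat
| RGet of nat & nat_expr          (* RGet a e : cell e of real array a *)
| RAdd of real_expr & real_expr
| RSub of real_expr & real_expr.

Inductive test : Type :=
| NLe of nat_expr & nat_expr
| RLe of real_expr & real_expr
| TNot of test
| TAnd of test & test.

Inductive cmd : Type :=
| Skip
| NSet of nat & nat_expr & nat_expr   (* NSet a i e : a[i] := e *)
| RSet of nat & nat_expr & real_expr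
| Seq of cmd & cmd
| If of test & cmd & cmd
| While of test & cmd.

Record memory (R : realType) : Type := Memory {
  nmem : nat -> nat -> nat;
  rmem : nat -> nat -> R
}.

Definition update (A : Type) (m : nat -> nat -> A) (a i : nat) (x : A) :
    nat -> nat -> A :=
  fun b j => if (b == a) && (j == i) then x else m b j.

Fixpoint neval (R : realType) (s : memory R) (e : nat_expr) : nat :=
  match e with
  | NConst c => c
  | NGet a i => nmem s a (neval s i)
  | NAdd e1 e2 => (neval s e1 + neval s e2)%N
  | NSub e1 e2 => (neval s e1 - neval s e2)%N
  end.

Fixpoint reval (R : realType) (s : memory R) (e : real_expr) : R :=
  match e with
  | RConst c => c%:R
  | RGet a i => rmem s a (neval s i)
  | RAdd e1 e2 => reval s e1 + reval s e2
  | RSub e1 e2 => reval s e1 - reval s e2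
  end.

Fixpoint teval (R : realType) (s : memory R) (b : test) : bool :=
  match b with
  | NLe e1 e2 => (neval s e1 <= neval s e2)%N
  | RLe e1 e2 => reval s e1 <= reval s e2
  | TNot b1 => ~~ teval s b1
  | TAnd b1 b2 => teval s b1 && teval s b2
  end.

(* A configuration is the stack of commands still to be executed together with
   the memory.  One step evaluates at most a constant number of expressions of
   the program text, hence has constant cost for a fixed program. *)
Definition step (R : realType) (cf : seq cmd * memory R) : seq cmd * memory R :=
  let: (K, s) := cf in
  match K with
  | [::] => ([::], s)
  | Skip :: K' => (K', s)
  | NSet a i e :: K' =>
      (K', Memory (update (nmem s) a (neval s i) (neval s e)) (rmem s))
  | RSet a i e :: K' =>
      (K', Memory (nmem s) (update (rmem s) a (neval s i) (reval s e)))
  | Seq c1 c2 :: K' => (c1 :: c2 :: K', s)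
  | If b c1 c2 :: K' => ((if teval s b then c1 else c2) :: K', s)
  | While b c :: K' => (if teval s b then c :: While b c :: K' else K', s)
  end.

Definition halts_in (R : realType) (c : cmd) (s : memory R) (t : nat)
    (s' : memory R) : Prop :=
  iter t (@step R) ([:: c], s) = ([::], s').

(* Input: n and k are the cells 0 and 1 of natural array 0; the abscissa and the
   ordinate of point i are the cells i of the real arrays 0 and 1. *)
Definition input_memory (R : realType) (n k : nat) (P : 'I_n -> R * R) :
    memory R :=
  Memory
    (fun a i => match a, i with 0, 0 => n | 0, 1 => k | _, _ => 0 end)%N
    (fun a i => match a, insub i : option 'I_n with
                | 0%N, Some j => (P j).1
                | 1%N, Some j => (P j).2
                | _, _ => 0
                end).

(* Output: the cells 0 and 1 of natural array 1 are the lengths of a list of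
   vertices, stored in natural array 2, and of a list of edges, whose endpoints
   are stored in natural arrays 3 and 4.  Repetitions are excluded so that the
   output has polynomial size. *)
Definition output_graph (R : realType) (n : nat) (s : memory R)
    (S : {set 'I_n}) (E : {set {set 'I_n}}) : Prop :=
  exists (vs : seq 'I_n) (es : seq ('I_n * 'I_n)),
    [/\ uniq vs /\ uniq es,
        [seq val v | v <- vs] = mkseq (nmem s 2) (nmem s 1 0),
        [seq (val e.1, val e.2) | e <- es] =
          mkseq (fun i => (nmem s 3 i, nmem s 4 i)) (nmem s 1 1),
        S = [set v in vs] &
        E = [set [set e.1; e.2] | e in es]].

Definition poly_bounded (f : nat -> nat) : Prop :=
  exists a d : nat, forall n : nat, (f n <= a * n ^ d + a)%N.

(* Main.v *)
Require Import Defs.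
From mathcomp Require Import all_boot all_order all_algebra.
From mathcomp Require Import reals exp.
From mathcomp Require Import zify ring lra.

Set Implicit Arguments.
Unset Strict Implicit.
Unset Printing Implicit Defensive.

Import Order.TTheory GRing.Theory Num.Theory.
Local Open Scope ring_scope.

(** The algorithm is the one of Ravi, Sundaram, Marathe, Rosenkrantz and Ravi.
    For every pair of points [p], [q], consider the points at distance at most
    [delta = d(p, q)] from [p], cut a square of side [2 delta] around [p] into
    about [k] cells, take [k] points from the most populated cells, and connect
    them by repeatedly joining the two closest points and discarding one of
    them; the shortest of these trees is returned.

    Let [L] be the length of a tree spanning [k] points, [p] one of them and [q]
    the farthest one from [p], and let [g] be the number of cells that the
    selection uses.  The [k] points lie in at least [g] cells, of side about
    [delta / sqrt k], hence [g delta / sqrt k = O(L)], and [delta <= L].  By the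
    pigeonhole principle, the closest pair among [i] of the selected points is at
    distance [O(delta / sqrt i)], and also [O(delta sqrt (g / (k i)))] when
    [i > g].  Summing, the tree has length
    [O(delta sqrt g) = O(sqrt (L * L sqrt k)) = O(k^(1/4) L)]. *)

(** The lower bounds on [L] are total-variation arguments: in a connected graph, the variation of a
    real function over the edges is at least its oscillation, so disjoint bumps around separated
    points force length. Such points are found in the cells by keeping one of four parity classes,
    where distinct cells are separated by a full cell. The most populated cells are taken because no
    [k] points of the ball then lie in fewer cells, so that [g] is at most the number of cells met
    by the unknown tree. The machine neither multiplies nor divides: coordinates are scaled by an
    integer [m] with [k <= m ^ 2 <= 4 * k], by repeated addition, and a cell index counts the
    thresholds passed, which makes sense even for [delta = 0]. The pigeonhole bounds are not summed
    explicitly: each is at most an increment of a square-root budget, and the sum telescopes. The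
    joins form a tree because, read backwards, each of them adds a leaf. *)

(** * Structured programs *)

(* The only loops are [for] loops whose bound is [n], the cell 0 of the input
   array, which makes the cost polynomial by construction. *)
Inductive prog : Type :=
| PSkip
| PN of nat & nat_expr & nat_expr
| PR of nat & nat_expr & real_expr
| PSeq of prog & prog
| PIf of test & prog & prog
| PFor of nat & prog.

Definition cell0 (a : nat) : nat_expr := NGet a (NConst 0).

Definition incr (a : nat) (e : nat_expr) : nat_expr := NAdd (NGet a e) (NConst 1).

Fixpoint compile (p : prog) : cmd :=
  match p with
  | PSkip => Skip
  | PN a i e => NSet a i e
  | PR a i e => RSet a i e
  | PSeq p1 p2 => Seq (compile p1) (compile p2)
  | PIf b p1 p2 => If b (compile p1) (compile p2)
  | PFor i p1 =>
      Seq (NSet i (NConst 0) (NConst 0))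
        (While (NLe (incr i (NConst 0)) (cell0 0))
           (Seq (compile p1) (NSet i (NConst 0) (incr i (NConst 0)))))
  end.

Section Semantics.
Variable R : realType.
Implicit Types (s : memory R) (p : prog).

Definition setn s (a i v : nat) : memory R :=
  Memory (update (nmem s) a i v) (rmem s).

Definition setr s (a i : nat) (v : R) : memory R :=
  Memory (nmem s) (update (rmem s) a i v).

(** The loop bound is read once, on entry, whereas the compiled loop tests it again at each round;
    [wf] makes the two agree. *)
Fixpoint sem p s : memory R :=
  match p with
  | PSkip => s
  | PN a i e => setn s a (neval s i) (neval s e)
  | PR a i e => setr s a (neval s i) (reval s e)
  | PSeq p1 p2 => sem p2 (sem p1 s)
  | PIf b p1 p2 => if teval s b then sem p1 s else sem p2 s
  | PFor i p1 =>
      iter (nmem s 0 0)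
        (fun s1 => let s2 := sem p1 s1 in setn s2 i 0 (nmem s2 i 0 + 1))
        (setn s i 0 0)
  end.

Fixpoint nwrites p : seq nat :=
  match p with
  | PN a _ _ => [:: a]
  | PSeq p1 p2 | PIf _ p1 p2 => nwrites p1 ++ nwrites p2
  | PFor i p1 => i :: nwrites p1
  | _ => [::]
  end.

Fixpoint rwrites p : seq nat :=
  match p with
  | PR a _ _ => [:: a]
  | PSeq p1 p2 | PIf _ p1 p2 => rwrites p1 ++ rwrites p2
  | PFor _ p1 => rwrites p1
  | _ => [::]
  end.

(* Loop counters are not written by the loop bodies, and nothing writes the
   input array that holds the loop bound. *)
Fixpoint wf p : bool :=
  match p with
  | PN a _ _ => a != 0%N
  | PSeq p1 p2 | PIf _ p1 p2 => wf p1 && wf p2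
  | PFor i p1 => [&& i != 0%N, i \notin nwrites p1 & wf p1]
  | _ => true
  end.

(** A round of a loop adds three steps (test, sequencing, increment), and the loop itself three more
    (sequencing, initialisation, final test). *)
Fixpoint cost p (n : nat) : nat :=
  match p with
  | PSeq p1 p2 | PIf _ p1 p2 => (cost p1 n + cost p2 n).+1
  | PFor _ p1 => (n * (cost p1 n + 3) + 3)%N
  | _ => 1%N
  end.

Lemma nframe p s a j : a \notin nwrites p -> nmem (sem p s) a j = nmem s a j.
Proof.
elim: p s => [|b i e|b i e|p1 IH1 p2 IH2|b p1 IH1 p2 IH2|i p1 IH] s //=.
- by rewrite inE /update => /negPf ->.
- by rewrite mem_cat negb_or => /andP[h1 h2]; rewrite IH2 // IH1.
- by rewrite mem_cat negb_or => /andP[h1 h2]; case: ifP => _; [rewrite IH1|rewrite IH2].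
- rewrite inE negb_or => /andP[/negPf hi h].
  by elim: (nmem s 0 0) => [|m IHm] /=; rewrite /update hi //= IH.
Qed.

Lemma rframe p s a j : a \notin rwrites p -> rmem (sem p s) a j = rmem s a j.
Proof.
elim: p s => [|b i e|b i e|p1 IH1 p2 IH2|b p1 IH1 p2 IH2|i p1 IH] s //=.
- by rewrite inE /update => /negPf ->.
- by rewrite mem_cat negb_or => /andP[h1 h2]; rewrite IH2 // IH1.
- by rewrite mem_cat negb_or => /andP[h1 h2]; case: ifP => _; [rewrite IH1|rewrite IH2].
- by move=> h; elim: (nmem s 0 0) => [|m IHm] //=; rewrite IH.
Qed.

Lemma wf_writes0 p : wf p -> 0%N \notin nwrites p.
Proof.
elim: p => [|b i e|b i e|p1 IH1 p2 IH2|b p1 IH1 p2 IH2|i p1 IH] //=.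
- by rewrite inE eq_sym.
- by case/andP=> /IH1 h1 /IH2 h2; rewrite mem_cat negb_or h1.
- by case/andP=> /IH1 h1 /IH2 h2; rewrite mem_cat negb_or h1.
- by case/and3P=> h1 h2 /IH h3; rewrite inE negb_or eq_sym h1.
Qed.

(** One [t] serves every stack [K], so that the step counts of subprograms add up when their runs
    are chained. *)
Lemma compileP p s : wf p ->
  exists2 t, (t <= cost p (nmem s 0 0))%N &
    forall K, iter t (@step R) (compile p :: K, s) = (K, sem p s).
Proof.
elim: p s => [|b i e|b i e|p1 IH1 p2 IH2|b p1 IH1 p2 IH2|i p1 IH] s /=.
- by exists 1%N.
- by exists 1%N.
- by exists 1%N.
- case/andP=> w1 w2.
  have [t1 le1 h1] := IH1 s w1; have [t2 le2 h2] := IH2 (sem p1 s) w2.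
  move: le2; rewrite nframe ?wf_writes0 // => le2.
  exists (t2 + t1).+1; first by rewrite ltnS addnC leq_add.
  by move=> K; rewrite iterSr iterD /= h1 h2.
- case/andP=> w1 w2.
  have [t1 le1 h1] := IH1 s w1; have [t2 le2 h2] := IH2 s w2.
  exists (if teval s b then t1 else t2).+1.
    rewrite ltnS; case: ifP => _; first exact: leq_trans (leq_addr _ _).
    exact: leq_trans (leq_addl _ _).
  by move=> K; rewrite iterSr /=; case: ifP.
- case/and3P=> i0 iw w.
  set n := nmem s 0 0.
  set W := While _ _; set body := fun s1 => _.
  (* The bound is intact and the counter equals the number of rounds done, so the compiled test
     succeeds exactly [n] times. *)
  have inv m : nmem (iter m body (setn s i 0 0)) 0 0 = n /\
               nmem (iter m body (setn s i 0 0)) i 0 = m.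
    have i0' : (0%N == i) = false by rewrite eq_sym (negPf i0).
    elim: m => [|m [{}IH1 IH2]] /=; first by rewrite /update !eqxx i0'.
    rewrite /body /update !eqxx /= i0' /=.
    by rewrite !nframe ?wf_writes0 // IH1 IH2 addn1.
  have run m : (m <= n)%N -> exists2 t, (t <= m * (cost p1 n + 3))%N &
      forall K, iter t (@step R) (W :: K, setn s i 0 0) = (W :: K, iter m body (setn s i 0 0)).
    elim: m => [|m IHm] lem; first by exists 0%N.
    have [t let_ ht] := IHm (ltnW lem).
    have [inv1 inv2] := inv m.
    have [t1 let1 ht1] := IH (iter m body (setn s i 0 0)) w.
    exists ((1 + (t1 + 2)) + t)%N.
      by move: let_ let1; rewrite inv1 mulSn; move: (m * _)%N => x; lia.
    move=> K; rewrite !iterD ht /= inv1 inv2 addn1 lem /= ht1.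
    by rewrite /= /body.
  have [t let_ ht] := run n (leqnn _).
  have [inv1 inv2] := inv n.
  exists (1 + (t + 2))%N; first by lia.
  by move=> K; rewrite !iterD /= ht /= inv1 inv2 addn1 ltnn.
Qed.

Lemma poly_cost p : poly_bounded (cost p).
Proof.
have cst c : poly_bounded (fun=> c) by exists c, 0%N => n; rewrite leq_addl.
have add f g : poly_bounded f -> poly_bounded g -> poly_bounded (fun n => f n + g n)%N.
  move=> [a [d ha]] [b [e hb]]; exists (a + b + a + b)%N, (d + e)%N => n.
  (* The [+ 1] is for [n = 0], where [0 ^ 0 = 1] while higher powers vanish. *)
  have le1 i j : (n ^ i <= n ^ (i + j) + 1)%N.
    case: n {ha hb} => [|n]; last by rewrite addn1 leqW // leq_pexp2l ?leq_addr.
    by case: i => [|i]; rewrite ?expn0 ?leq_addl // exp0n.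
  have {}ha : (f n <= a * (n ^ (d + e) + 1) + a)%N.
    by apply: leq_trans (ha n) _; rewrite leq_add2r leq_mul2l le1 orbT.
  have {}hb : (g n <= b * (n ^ (d + e) + 1) + b)%N.
    by apply: leq_trans (hb n) _; rewrite leq_add2r leq_mul2l (addnC d) le1 orbT.
  apply: leq_trans (leq_add ha hb) _; move: (n ^ (d + e))%N => x.
  by rewrite !mulnDl !mulnDr; lia.
have muln f : poly_bounded f -> poly_bounded (fun n => n * f n)%N.
  move=> [a [d ha]]; exists (a + a)%N, d.+1 => n.
  case: n => [|n]; first by rewrite mul0n.
  apply: leq_trans (leq_mul (leqnn _) (ha n.+1)) _.
  have : (n.+1 <= n.+1 ^ d.+1)%N by rewrite -{1}(expn1 n.+1) leq_pexp2l.
  rewrite mulnDr mulnCA -expnS; move: (n.+1 ^ d.+1)%N => x h.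
  have : (n.+1 * a <= x * a)%N by rewrite leq_mul2r h orbT.
  by nia.
elim: p => [|b i e|b i e|p1 IH1 p2 IH2|b p1 IH1 p2 IH2|i p1 IH] /=; try exact: cst.
- by apply: (add (fun=> 1%N)) => //; apply: add.
- by apply: (add (fun=> 1%N)) => //; apply: add.
- by apply: (add _ (fun=> 3)) => //; apply: muln; apply: (add _ (fun=> 3)).
Qed.

(** Invariant rule for loops. The step may assume the frame conditions, so an invariant only speaks
    of what the loop writes. *)
Lemma sem_for (Inv : nat -> memory R -> Prop) i p s :
    wf (PFor i p) ->
    Inv 0%N (setn s i 0 0) ->
    (forall j s', (j < nmem s 0 0)%N ->
       nmem s' i 0 = j ->
       (forall a x, a \notin nwrites (PFor i p) -> nmem s' a x = nmem s a x) ->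
       (forall a x, a \notin rwrites (PFor i p) -> rmem s' a x = rmem s a x) ->
       Inv j s' -> Inv j.+1 (setn (sem p s') i 0 j.+1)) ->
  Inv (nmem s 0 0) (sem (PFor i p) s).
Proof.
move=> /= /and3P[i0 iw w] Inv0 IH.
set n := nmem s 0 0; set body := fun s1 => _.
suff H m : (m <= n)%N -> Inv m (iter m body (setn s i 0 0)) by apply: H.
elim: m => [|m IHm] lem //=.
have inv1 j : nmem (iter j body (setn s i 0 0)) i 0 = j.
  by elim: j => [|j IHj] /=; rewrite /update !eqxx //= nframe // IHj addn1.
rewrite {1}/body nframe // inv1 addn1; apply: IH => //.
- move=> a x ha.
  move: ha; rewrite inE negb_or => /andP[/negPf hi h].
  by elim: {lem IHm} m => [|m IHm] /=; rewrite /update hi //= nframe.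
- by move=> a x ha; elim: {lem IHm} m => [|m IHm] //=; rewrite rframe.
- exact: IHm (ltnW lem).
Qed.

End Semantics.

(** * Trees and rectilinear length *)

Section Metric.
Variable R : realType.
Implicit Types p q r : R * R.

Lemma l1_distC p q : l1_dist p q = l1_dist q p.
Proof. by rewrite /l1_dist distrC [X in _ + X]distrC. Qed.

Lemma l1_dist_ge0 p q : 0 <= l1_dist p q.
Proof. by rewrite addr_ge0. Qed.

Lemma l1_distxx p : l1_dist p p = 0.
Proof. by rewrite /l1_dist !subrr normr0 addr0. Qed.

Lemma l1_dist_triangle q p r : l1_dist p r <= l1_dist p q + l1_dist q r.
Proof. by rewrite /l1_dist addrACA lerD // ler_distD. Qed.

Lemma l1_dist_lipschitz r p q : `|l1_dist r p - l1_dist r q| <= l1_dist p q.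
Proof.
have h1 := l1_dist_triangle q r p; have h2 := l1_dist_triangle p r q.
by rewrite (l1_distC q p) in h1; rewrite ler_norml; apply/andP; split; lra.
Qed.

End Metric.

(** * Lower bounds on the length by total variation *)

Lemma adjacentC (T : finType) (F : {set {set T}}) : symmetric (adjacent F).
Proof. by move=> u v; rewrite /adjacent setUC. Qed.

(** The triangle inequality along a simple path. Deleting the first vertex of the path discards its
    first edge, so no edge is charged twice. *)
Lemma variation_connect (R : realType) (n : nat) (E : {set {set 'I_n}}) (f : 'I_n -> R) a b :
    connect (adjacent E) a b ->
  `|f a - f b| <= \sum_(u : 'I_n) \sum_(v : 'I_n | (u < v)%N && adjacent E u v) `|f u - f v|.
Proof.
pose w u v : R := `|f u - f v|.
have w_ge0 u v : 0 <= w u v by rewrite /w.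
(* Ordered pairs count every edge twice, but spare the comparison of the indices of its
   endpoints. *)
pose F (A : {set 'I_n}) : R := \sum_(u in A) \sum_(v in A | adjacent E u v) w u v.
have FD1 (A : {set 'I_n}) x y : x \in A -> y \in A -> y != x -> adjacent E x y ->
    w x y *+ 2 + F (A :\ x) <= F A.
  move=> xA yA yx xy; rewrite /F [leRHS](big_setD1 x xA) /= mulr2n -addrA lerD //.
    by rewrite (bigD1 y) ?yA //= lerDl; apply: sumr_ge0.
  have yAx : y \in A :\ x by rewrite !inE yx.
  have row u : \sum_(v in A | adjacent E u v) w u v =
      (if adjacent E u x then w u x else 0) + \sum_(v in A :\ x | adjacent E u v) w u v.
    rewrite (bigID (pred1 x)) /=; congr (_ + _).
      case: ifP => h; first by rewrite (big_pred1 x) // => v /=; case: eqP => [->|_]; rewrite ?xA ?h ?andbF.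
      by rewrite big_pred0 // => v /=; case: eqP => [->|_]; rewrite ?h ?andbF.
    by apply: eq_bigl => v; rewrite !inE; case: (v == x); case: (v \in A); case: (adjacent _ _ _).
  rewrite (eq_bigr _ (fun u _ => row u)) big_split /= lerD2r.
  rewrite (bigD1 y) //= adjacentC xy -[leLHS]addr0 lerD //; first by rewrite /w distrC.
  by apply: sumr_ge0 => u _; case: ifP.
have two : F setT = (\sum_(u : 'I_n) \sum_(v : 'I_n | (u < v)%N && adjacent E u v) w u v) *+ 2.
  rewrite /F mulr2n.
  have -> : \sum_(u in [set: 'I_n]) \sum_(v in [set: 'I_n] | adjacent E u v) w u v =
    \sum_(u : 'I_n) (\sum_(v : 'I_n | (u < v)%N && adjacent E u v) w u v +
            \sum_(v : 'I_n | (v < u)%N && adjacent E u v) w u v).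
    apply: eq_big => [u|u _]; first by rewrite inE.
    rewrite (bigID (fun v : 'I_n => (u < v)%N)) /=; congr (_ + _).
      by apply: eq_bigl => v; rewrite inE andbC.
    rewrite (bigID (fun v : 'I_n => v == u)) /= big1 ?add0r; last first.
      by move=> v /andP[_ /eqP->]; rewrite /w subrr normr0.
    apply: eq_bigl => v; rewrite inE /= -leqNgt ltn_neqAle -val_eqE.
    by case: (_ == _); case: (_ <= _)%N; case: (adjacent _ _ _).
  rewrite big_split /=; congr (_ + _).
  rewrite (exchange_big_dep xpredT) //=; apply: eq_bigr => u _.
  by apply: eq_big => [v|v _]; rewrite 1?(adjacentC _ v) // /w distrC.
case/connectP=> p pp ->.
suff H p0 (A : {set 'I_n}) : {subset a :: p0 <= A} -> uniq (a :: p0) -> path (adjacent E) a p0 ->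
    `|f a - f (last a p0)| *+ 2 <= F A.
  case: (shortenP pp) => p' pp' up' _; rewrite -(ler_pMn2r (n := 2)) // -two.
  by apply: H => // z _; rewrite inE.
elim: p0 a A {p pp} => [|y p IH] x A sA /=.
  by rewrite subrr normr0 mul0rn !sumr_ge0 // => u _; rewrite sumr_ge0.
case/andP=> xp up /andP[xy yp].
have xA : x \in A by rewrite sA ?mem_head.
have yA : y \in A by rewrite sA // !inE eqxx orbT.
have yx : y != x by apply: contraNneq xp => <-; rewrite mem_head.
apply: le_trans (FD1 _ _ _ xA yA yx xy).
have {}IH : `|f y - f (last y p)| *+ 2 <= F (A :\ x).
  apply: IH => // z zp; apply/setD1P; split; first by apply: contraNneq xp => <-.
  by apply: sA; rewrite in_cons zp orbT.
apply: le_trans (lerD (lexx _) IH); rewrite -mulrnDl ler_pMn2r //.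
exact: ler_distD.
Qed.

(** For a family of test functions that is jointly [c]-Lipschitz; [variation_connect] bounds the
    left-hand side from below. *)
Lemma variation_le_rect_length (R : realType) (n : nat) (P : 'I_n -> R * R)
    (E : {set {set 'I_n}}) (I : finType) (A : {set I}) (f : I -> 'I_n -> R) (c : R) :
    (forall u v, \sum_(i in A) `|f i u - f i v| <= c * l1_dist (P u) (P v)) ->
  \sum_(i in A) \sum_(u : 'I_n) \sum_(v : 'I_n | (u < v)%N && adjacent E u v) `|f i u - f i v|
    <= c * rect_length P E.
Proof.
move=> H; rewrite exchange_big /= mulr_sumr; apply: ler_sum => u _.
by rewrite exchange_big /= mulr_sumr; apply: ler_sum => v _.
Qed.

(** The test function is the distance to [b], seen as a family indexed by one element. *)
Lemma dist_le_rect_length (R : realType) (n : nat) (P : 'I_n -> R * R) S E a b :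
    is_connected S E -> a \in S -> b \in S ->
  l1_dist (P a) (P b) <= rect_length P E.
Proof.
move=> cSE aS bS; have := variation_connect (fun u => l1_dist (P b) (P u)) (cSE a b aS bS).
rewrite l1_distxx subr0 ger0_norm ?l1_dist_ge0 // l1_distC => /le_trans; apply.
rewrite -[leRHS]mul1r.
have H u v : \sum_(i in [set: 'I_1]) `|l1_dist (P b) (P u) - l1_dist (P b) (P v)|
     <= 1 * l1_dist (P u) (P v).
  by rewrite big_const cardsT card_ord /= addr0 mul1r l1_dist_lipschitz.
have := variation_le_rect_length E H.
by rewrite big_const cardsT card_ord /= addr0.
Qed.

Lemma rect_length_ge0 (R : realType) (n : nat) (P : 'I_n -> R * R) E : 0 <= rect_length P E.
Proof. by apply: sumr_ge0 => u _; apply: sumr_ge0 => v _; apply: l1_dist_ge0. Qed.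

Lemma sum_support2 (R : numDomainType) (I : finType) (A : {set I}) (F : I -> R) i j :
    i != j -> i \in A -> j \in A -> (forall x, x \in A -> x != i -> x != j -> F x = 0) ->
  \sum_(x in A) F x = F i + F j.
Proof.
move=> ij iA jA H; rewrite (bigD1 i) //= (bigD1 j) ?jA 1?eq_sym //= big1 ?addr0 //.
by move=> x /andP[/andP[xA xi] xj]; apply: H.
Qed.

Lemma sum_support1 (R : numDomainType) (I : finType) (A : {set I}) (F : I -> R) i :
    i \in A -> (forall x, x \in A -> x != i -> F x = 0) ->
  \sum_(x in A) F x = F i.
Proof.
move=> iA H; rewrite (bigD1 i) //= big1 ?addr0 //.
by move=> x /andP[xA xi]; apply: H.
Qed.

(* The balls of radius [s / 2] around the points of [H] are disjoint, and the
   tree has length at least [s / 2] inside each of them. *)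
Lemma packing_le_rect_length (R : realType) (n : nat) (P : 'I_n -> R * R) S E
    (H : {set 'I_n}) (s : R) :
    is_connected S E -> H \subset S -> (1 < #|H|)%N -> 0 <= s ->
    {in H &, forall u v, u != v -> s <= l1_dist (P u) (P v)} ->
  #|H|%:R * s <= 2 * rect_length P E.
Proof.
move=> cSE /subsetP HS H2 s0 sep.
pose d u v := l1_dist (P u) (P v).
(* A bump of height [s] and slope 2, nonzero only within distance [s / 2] of [h]. *)
pose f h u := Num.max 0 (s - 2 * d h u).
have f_ge0 h u : 0 <= f h u by rewrite le_max lexx.
have f0 h u : f h u != 0 -> f h u = s - 2 * d h u /\ 2 * d h u < s.
  rewrite /f; case: (leP 0 (s - 2 * d h u)) => h1; rewrite ?eqxx // => h2; split => //.
  by rewrite lt_neqAle; move: h2; rewrite subr_eq0 eq_sym => ->; rewrite -subr_ge0.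
have tri h u v : d h v <= d h u + d u v by apply: l1_dist_triangle.
have fH h h' u : h \in H -> h' \in H -> f h u != 0 -> h' != h -> f h' u = 0.
  move=> hH h'H /f0[_ h1] hh'; apply/eqP; apply: contraT => /f0[_ h2].
  have := sep _ _ h'H hH hh'; have := tri h' u h.
  by rewrite /d [l1_dist (P u) (P h)]l1_distC -!/(d _ _) => h3 h4; lra.
have lip h u v : `|f h u - f h v| <= 2 * d u v.
  have h1 := tri h u v; have h2 := tri h v u.
  have h3 : d v u = d u v by rewrite /d l1_distC.
  have h4 : 0 <= d u v by apply: l1_dist_ge0.
  rewrite ler_norml /f.
  by case: (leP 0 (s - 2 * d h u)); case: (leP 0 (s - 2 * d h v)) => *; apply/andP; split; lra.
have sumle u v : \sum_(h in H) `|f h u - f h v| <= 2 * d u v.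
  have d0 : 0 <= 2 * d u v by rewrite mulr_ge0 // l1_dist_ge0.
  case: (pickP (fun h => (h \in H) && (f h u != 0))) => [h /andP[hH hu]|nou]; last first.
    have {}nou h : h \in H -> f h u = 0.
      by move=> hH; apply/eqP; have := nou h; rewrite hH /= => /negbFE.
    case: (pickP (fun h => (h \in H) && (f h v != 0))) => [h /andP[hH hv]|nov]; last first.
      rewrite big1 // => h hH; rewrite nou // sub0r normrN.
      by have := nov h; rewrite hH /= => /negbFE/eqP->; rewrite normr0.
    rewrite (sum_support1 hH) ?lip // => x xH xh.
    by rewrite nou // (fH h x v) // subr0 normr0.
  (* At most one bump is nonzero at [u], and at most one at [v]. If they differ, [s <= d h h'] gives
     [(s - 2 * d h u) + (s - 2 * d h' v) <= 2 * d u v]. *)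
  case: (pickP (fun h' => [&& h' \in H, h' != h & f h' v != 0])) => [h' /and3P[h'H hh' hv]|nov].
    have hh := hh'; rewrite eq_sym in hh.
    rewrite (sum_support2 hh hH h'H) => [|x xH xh xh']; last first.
      by rewrite (fH h x u) // (fH h' x v) // subr0 normr0.
    rewrite (fH h h' u) // (fH h' h v) // subr0 sub0r normrN !ger0_norm //.
    have [-> h1] := f0 _ _ hu; have [-> h2] := f0 _ _ hv.
    have := sep _ _ hH h'H; rewrite eq_sym => /(_ hh') h3.
    have h4 := tri h u h'; have h5 := tri u v h'.
    have h6 : d v h' = d h' v by rewrite /d l1_distC.
    by rewrite -/(d h h') in h3; lra.
  rewrite (sum_support1 hH) ?lip // => x xH xh.
  rewrite (fH h x u) // sub0r normrN.
  by have := nov x; rewrite xH xh /= => /negbFE/eqP->; rewrite normr0.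
apply: le_trans (variation_le_rect_length E sumle).
rewrite -sum1_card natr_sum mulr_suml; apply: ler_sum => h hH; rewrite mul1r.
(* At a second point of [H], the bump around [h] has come down from [s] to 0. *)
have [h' /setD1P[hh' h'H]] : exists h', h' \in H :\ h.
  by apply/set0Pn; rewrite -card_gt0; move: H2; rewrite (cardsD1 h) hH.
apply: le_trans (variation_connect (f h) (cSE _ _ (HS _ hH) (HS _ h'H))).
have -> : f h h = s by rewrite /f /d l1_distxx mulr0 subr0 max_r.
rewrite [f h h'](_ : _ = 0) ?subr0 ?ler_norm //.
apply/eqP; apply: contraT => /f0[_ h2].
have := sep _ _ hH h'H; rewrite eq_sym => /(_ hh'); rewrite -/(d h h') => h3.
by have := l1_dist_ge0 (P h) (P h'); rewrite -/(d h h') => h4; lra.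
Qed.

(** * Trees grown leaf by leaf *)

Lemma tree_singleton (T : finType) (u : T) : is_tree [set u] (set0 : {set {set T}}).
Proof.
split=> [||x y|[|x [|y c]] //].
- by apply/set0Pn; exists u; rewrite inE.
- by move=> e; rewrite inE.
- by rewrite !inE => /eqP-> /eqP->.
- by move=> _ _ /=; rewrite {1}/adjacent inE.
Qed.

Lemma adjacent_leaf (T : finType) (E : {set {set T}}) (u v x y : T) : x != u -> y != u ->
  adjacent ([set u; v] |: E) x y = adjacent E x y.
Proof.
move=> xu yu; rewrite /adjacent in_setU1.
suff -> : ([set x; y] == [set u; v]) = false by [].
apply/eqP => /setP/(_ u); rewrite !inE eqxx /= !(eq_sym u).
by rewrite (negPf xu) (negPf yu).
Qed.

Lemma adjacent_mem (T : finType) S (E : {set {set T}}) x y : is_graph S E ->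
  adjacent E x y -> [/\ x \in S, y \in S & x != y].
Proof.
move=> gE /gE[/subsetP sub c2]; split; try by apply: sub; rewrite !inE eqxx ?orbT.
by apply: contra_eqN c2 => /eqP->; rewrite setUid cards1.
Qed.

Lemma adjacent_leafl (T : finType) (S : {set T}) (E : {set {set T}}) (u v y : T) :
    is_graph S E -> u \notin S ->
  adjacent ([set u; v] |: E) u y -> y = v \/ y = u.
Proof.
move=> gE uS; rewrite /adjacent in_setU1 => /orP[/eqP/setP/(_ y)|/(adjacent_mem gE)[]].
  by rewrite !inE eqxx orbT => /esym/orP[]/eqP; tauto.
by rewrite (negPf uS).
Qed.

(** A cycle through [u] would give it two distinct neighbours, but [v] is the only one; a cycle
    avoiding [u] lives in [E]. *)
Lemma tree_leaf (T : finType) (S : {set T}) (E : {set {set T}}) (u v : T) :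
    is_tree S E -> v \in S -> u \notin S ->
  is_tree (u |: S) ([set u; v] |: E).
Proof.
move=> [S0 gE cE aE] vS uS.
have uv : u != v by apply: contraNneq uS => ->.
split.
- by apply/set0Pn; exists u; rewrite setU11.
- move=> e; rewrite in_setU1 => /orP[/eqP->|/gE[sub c2]].
    rewrite cards2 uv; split=> //; apply/subsetP => x; rewrite !inE.
    by case/orP=> /eqP->; rewrite ?eqxx ?vS ?orbT.
  by split=> //; apply: subset_trans sub (subsetUr _ _).
- have cS x y : x \in S -> y \in S -> connect (adjacent ([set u; v] |: E)) x y.
    move=> xS yS; apply: connect_sub (cE x y xS yS) => {x y xS yS} x y xy.
    by apply: connect1; move: xy; rewrite /adjacent in_setU1 orbC => ->.
  have csym := sym_connect_sym (@adjacentC _ ([set u; v] |: E)).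
  have cuv : connect (adjacent ([set u; v] |: E)) u v.
    by apply: connect1; rewrite /adjacent setU11.
  move=> x y; rewrite !in_setU1 => /orP[/eqP->|xS] /orP[/eqP->|yS] //.
  + exact: connect_trans cuv (cS _ _ vS yS).
  + by rewrite csym; apply: connect_trans cuv (cS _ _ vS xS).
  + exact: cS.
- move=> c sc uc; apply/negP => cc.
  have [uinc|unc] := boolP (u \in c); last first.
    have /negP := aE c sc uc; apply.
    rewrite -(eq_in_cycle (P := predC1 u) (e := adjacent ([set u; v] |: E))) //.
      by move=> x y; rewrite !inE; apply: adjacent_leaf.
    by apply/allP => x xc; rewrite inE; apply: contraNneq unc => <-.
  case/rot_to: uinc => i c' rc.
  move: cc; rewrite -(rot_cycle i) rc; move: uc; rewrite -(rot_uniq i) rc.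
  move: sc; rewrite -(size_rot i) rc.
  case: c' {rc} => [|x c'] //=; case/lastP: c' => [|c' z] //= _.
  rewrite !rcons_path last_rcons !inE mem_rcons !inE.
  case/and3P=> un xn _ /and3P[ux _ zu].
  have [ex|ex] := adjacent_leafl gE uS ux; last by move: un; rewrite ex eqxx.
  have [ez|ez] := adjacent_leafl gE uS (etrans (adjacentC _ _ _) zu).
    by move: xn; rewrite ex -ez mem_rcons mem_head.
  by move: un; rewrite ez eqxx ?orbT.
Qed.

Lemma rect_length_leaf (R : realType) (n : nat) (P : 'I_n -> R * R)
    (E : {set {set 'I_n}}) (u v : 'I_n) :
    u != v -> [set u; v] \notin E ->
  rect_length P ([set u; v] |: E) = l1_dist (P u) (P v) + rect_length P E.
Proof.
wlog uv : u v / (u < v)%N.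
  move=> W uv uvE; case: (ltngtP u v) => h; first exact: W.
    by rewrite (setUC [set u]) [l1_dist _ _]l1_distC W // ?(setUC [set v]) // eq_sym.
  by move: uv; rewrite -val_eqE /= h eqxx.
move=> _ uvE; rewrite /rect_length.
pose w (x y : 'I_n) := l1_dist (P x) (P y).
pose new (p : 'I_n * 'I_n) := (p.1 < p.2)%N && ([set p.1; p.2] == [set u; v]).
have newE : new =1 pred1 (u, v).
  move=> [x y]; rewrite /new /= xpair_eqE; apply/idP/andP => [/andP[xy /eqP e]|[/eqP-> /eqP->]]; last first.
    by rewrite uv eqxx.
  have : x \in [set u; v] by rewrite -e !inE eqxx.
  have : y \in [set u; v] by rewrite -e !inE eqxx orbT.
  rewrite !inE => /orP[]/eqP ey /orP[]/eqP ex; move: xy; rewrite ex ey ?eqxx ?ltnn //.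
  by rewrite ltnNge (ltnW uv).
rewrite [RHS](_ : _ = \sum_(p : 'I_n * 'I_n | new p) w p.1 p.2 + rect_length P E); last first.
  by rewrite (eq_bigl _ _ newE) big_pred1_eq.
rewrite /rect_length !pair_big_dep /= [LHS]big_mkcond [X in X + _]big_mkcond [X in _ + X]big_mkcond.
rewrite -big_split /=; apply: eq_bigr => -[x y] _ /=.
rewrite {1}/adjacent in_setU1 /new /=.
case: (ltnP x y) => //= xy; last by rewrite addr0.
case: eqP => [e|_]; last by rewrite add0r.
by rewrite /adjacent e (negPf uvE) addr0.
Qed.

(** * Length forced by the number of cells met *)

(** The element picked depends only on the value of [f], so one point of each fibre is kept. *)
Lemma transversal_imset (T U : finType) (f : T -> U) (A : {set T}) :
  exists H : {set T}, [/\ H \subset A, {in H &, injective f} & f @: H = f @: A].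
Proof.
pose H := [set u in A | [pick v in A | f v == f u] == Some u].
have HA : H \subset A by apply/subsetP => u; rewrite inE => /andP[].
exists H; split=> //.
- move=> u v; rewrite !inE => /andP[_ /eqP hu] /andP[_ /eqP hv] fuv.
  by move: hu; rewrite fuv hv => -[].
- apply/eqP; rewrite eqEsubset imsetS //=.
  apply/subsetP => _ /imsetP[u uA ->].
  have : exists v, [pick v in A | f v == f u] = Some v.
    case: pickP => [v _|/(_ u)]; first by exists v.
    by rewrite uA eqxx.
  case=> v hv; have [vA fv] : v \in A /\ f v = f u.
    by move: hv; case: pickP => // w /andP[wA /eqP fw] [<-].
  by rewrite -fv; apply: imset_f; rewrite inE vA fv hv eqxx.
Qed.

(* [par] splits the cells in four classes, such as the parities of the two
   coordinates, in which distinct cells are far apart. *)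
Lemma cells_le_rect_length (R : realType) (n : nat) (P : 'I_n -> R * R) S E
    (U : finType) (cell : 'I_n -> U) (par : U -> bool * bool) (s : R) :
    is_connected S E -> 0 <= s -> s <= 2 * rect_length P E ->
    {in S &, forall u v, cell u != cell v -> par (cell u) = par (cell v) ->
       s <= l1_dist (P u) (P v)} ->
  #|cell @: S|%:R * s <= 8 * rect_length P E.
Proof.
move=> cSE s0 sL far.
pose A c := [set u in S | par (cell u) == c].
have AS c : A c \subset S by apply/subsetP => u; rewrite inE => /andP[].
(* [packing_le_rect_length] needs two points; a class meeting a single cell is covered by
   [s <= 2 * rect_length P E]. The four classes give the factor 8. *)
have HA c : #|cell @: A c|%:R * s <= 2 * rect_length P E.
  have [H [HA injH <-]] := transversal_imset cell (A c).
  rewrite card_in_imset //; case: (ltngtP 1 #|H|) => h; last by rewrite -h mul1r.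
    apply: packing_le_rect_length (subset_trans HA (AS c)) h s0 _ => //.
    move=> u v uH vH uv; have := subsetP HA _ uH; have := subsetP HA _ vH.
    rewrite !inE => /andP[vS /eqP pv] /andP[uS /eqP pu].
    by apply: far; rewrite ?pu ?pv //; apply: contra_neq uv; apply: injH.
  by move: h; rewrite ltnS leqn0 => /eqP->; rewrite mul0r mulr_ge0 // rect_length_ge0.
have SA : S = \bigcup_c A c.
  apply/setP => u; apply/idP/bigcupP => [uS|[c _ /(subsetP (AS c))]//].
  by exists (par (cell u)) => //; rewrite inE uS eqxx.
have le : (#|cell @: S| <= \sum_(c : bool * bool) #|cell @: A c|)%N.
  have -> : cell @: S = \bigcup_c cell @: A c.
    rewrite {1}SA; apply/setP => x; apply/imsetP/bigcupP => [[u /bigcupP[c _ uA] ->]|[c _ /imsetP[u uA ->]]].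
      by exists c => //; apply: imset_f.
    by exists u => //; apply/bigcupP; exists c.
  elim/big_rec2: _ => [|c m B _ IH]; first by rewrite cards0.
  by apply: leq_trans (leq_card_setU _ _) _; rewrite leq_add2l.
apply: le_trans (ler_wpM2r s0 (_ : _ <= (\sum_(c : bool * bool) #|cell @: A c|)%:R)) _.
  by rewrite ler_nat.
rewrite natr_sum mulr_suml; apply: le_trans (ler_sum _ (fun c _ => HA c)) _.
rewrite big_const card_prod !card_bool /= addr0; lra.
Qed.

(** * Grids and selection of cells *)

(* One plus the integer part of [z / w], capped by [N]; all the thresholds are
   passed when [w = 0]. *)
Definition tcount (R : realType) (N : nat) (w z : R) : nat :=
  (\sum_(j < N) nat_of_bool (w *+ j <= z)%R)%N.

Lemma tcount_leq (R : realType) N (w z : R) : (tcount N w z <= N)%N.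
Proof.
rewrite -[leqRHS]card_ord -sum1_card /tcount.
by apply: leq_sum => j _; case: (_ <= _).
Qed.

(** For [w >= 0] the thresholds passed form an initial segment, so counting them locates the last
    one. *)
Lemma ltn_tcount (R : realType) N (w z : R) j : 0 <= w -> (j < N)%N ->
  (j < tcount N w z)%N = (w *+ j <= z).
Proof.
move=> w0; elim: N j => // N IH j; rewrite /tcount big_ord_recr /= -/(tcount N w z) => jN.
have mono i : (i <= N)%N -> w *+ N <= z -> w *+ i <= z.
  by move=> iN; apply: le_trans; rewrite ler_wpMn2l.
have le := tcount_leq N w z.
have [h|h] := boolP (w *+ N <= z).
  rewrite mono // addn1 ltnS.
  have -> : tcount N w z = N.
    apply/eqP; rewrite eqn_leq le /= leqNgt; apply/negP => lt.
    by have := IH _ lt; rewrite ltnn mono // ltnW.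
  by [].
rewrite addn0; move: jN; rewrite ltnS leq_eqVlt => /orP[/eqP->|]; last exact: IH.
by rewrite (negPf h) ltnNge le.
Qed.

(** Indices start at 1, and the cap puts the far end [z = w *+ N] in the last cell. *)
Lemma tcount_bounds (R : realType) N (w z : R) : (0 < N)%N -> 0 <= w -> 0 <= z -> z <= w *+ N ->
  [/\ (0 < tcount N w z)%N, w *+ (tcount N w z).-1 <= z & z <= w *+ tcount N w z].
Proof.
move=> N0 w0 z0 zN.
have c0 : (0 < tcount N w z)%N by rewrite ltn_tcount.
have cN := tcount_leq N w z.
split=> //; first by rewrite -(@ltn_tcount _ N) //; lia.
have [lt|ge] := ltnP (tcount N w z) N; last by have -> : tcount N w z = N by lia.
by have := ltn_tcount z w0 lt; rewrite ltnn => /esym/negbT; rewrite -ltNge => /ltW.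
Qed.

Lemma tcount_near (R : realType) N (w z z' : R) : (0 < N)%N -> 0 <= w ->
    0 <= z -> z <= w *+ N -> 0 <= z' -> z' <= w *+ N -> tcount N w z = tcount N w z' ->
  `|z - z'| <= w.
Proof.
move=> N0 w0 z0 zN z0' zN' e.
have [c0 h1 h2] := tcount_bounds N0 w0 z0 zN.
have [_ h1' h2'] := tcount_bounds N0 w0 z0' zN'.
rewrite -e in h1' h2'.
have e2 : w *+ tcount N w z = w + w *+ (tcount N w z).-1 by rewrite -mulrS prednK.
by rewrite ler_norml; apply/andP; split; lra.
Qed.

Lemma tcount_far (R : realType) N (w z z' : R) : (0 < N)%N -> 0 <= w ->
    0 <= z -> z <= w *+ N -> 0 <= z' -> z' <= w *+ N ->
    ((tcount N w z).+2 <= tcount N w z')%N ->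
  w <= z' - z.
Proof.
move=> N0 w0 z0 zN z0' zN' e.
have [_ h1 h2] := tcount_bounds N0 w0 z0 zN.
have [c0' h1' h2'] := tcount_bounds N0 w0 z0' zN'.
have : w *+ (tcount N w z).+1 <= w *+ (tcount N w z').-1 by rewrite ler_wpMn2l //; lia.
by rewrite mulrS; lra.
Qed.

(** [f] and [g] are coordinates inside a cell, which is cut into [q] by [q] subcells: two points
    share both cell and subcell. Values are scaled by [q], so that subcells have side [a] and no
    division occurs. *)
Lemma pigeonhole (R : realType) (I U : finType) (A : {set I}) (cell : I -> U) (q : nat) (a : R)
    (f g : I -> R) : (0 < q)%N -> 0 <= a ->
    {in A, forall u, 0 <= f u <= a} -> {in A, forall u, 0 <= g u <= a} ->
    (#|cell @: A| * q ^ 2 < #|A|)%N ->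
  exists u v, [/\ u \in A, v \in A, u != v, cell u = cell v &
    (`|f u - f v| *+ q <= a) /\ (`|g u - g v| *+ q <= a)].
Proof.
case: q => // q _ a0 fA gA card.
pose sub (h : I -> R) u : 'I_q.+1 := inord (tcount q.+1 a (h u *+ q.+1)).-1.
pose phi u := (cell u, (sub f u, sub g u)).
have near h u v : {in A, forall u, 0 <= h u <= a} -> u \in A -> v \in A -> sub h u = sub h v ->
    `|h u - h v| *+ q.+1 <= a.
  move=> hA uA vA /(congr1 val).
  have /andP[u0 ua] := hA _ uA; have /andP[v0 va] := hA _ vA.
  have b x : 0 <= x -> x <= a -> 0 <= x *+ q.+1 /\ x *+ q.+1 <= a *+ q.+1.
    by move=> x0 xa; rewrite mulrn_wge0 // ler_wMn2r.
  have [bu1 bu2] := b _ u0 ua; have [bv1 bv2] := b _ v0 va.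
  have [cu _ _] := tcount_bounds (ltn0Sn q) a0 bu1 bu2.
  have [cv _ _] := tcount_bounds (ltn0Sn q) a0 bv1 bv2.
  have lu := tcount_leq q.+1 a (h u *+ q.+1); have lv := tcount_leq q.+1 a (h v *+ q.+1).
  rewrite /= !inordK ?prednK //.
  move=> e; rewrite -normrMn mulrnBl; apply: (@tcount_near _ q.+1) => //.
  by rewrite -(prednK cu) -(prednK cv) e.
have [/existsP[u /existsP[v /and4P[uA vA uv /eqP[e1 e2 e3]]]]|no] :=
  boolP [exists x, exists y, [&& x \in A, y \in A, x != y & phi x == phi y]].
  by exists u, v; split=> //; split; apply: near.
have inj : {in A &, injective phi}.
  move=> u v uA vA e; apply/eqP; apply: contraNT no => uv.
  by apply/existsP; exists u; apply/existsP; exists v; rewrite uA vA uv e eqxx.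
have : (#|phi @: A| <= #|setX (cell @: A) [set: 'I_q.+1 * 'I_q.+1]|)%N.
  apply/subset_leq_card/subsetP => _ /imsetP[u uA ->].
  by rewrite in_setX imset_f // inE.
rewrite card_in_imset // cardsX cardsT card_prod !card_ord mulnn leqNgt.
by rewrite card.
Qed.

(** * Choosing [k] points in as few cells as possible *)

Section Rank.
Variables (I : finType) (lt : rel I) (B : {set I}) (k : nat).
Hypothesis rel_irr : irreflexive lt.
Hypothesis rel_trans : transitive lt.
Hypothesis rel_total : forall u v, u != v -> lt u v || lt v u.

Let rank u := #|[set v in B | lt v u]|.
Let Sel := [set u in B | (rank u < k)%N].

Lemma rank_lt u v : u \in B -> lt u v -> (rank u < rank v)%N.
Proof.
move=> uB uv; apply/proper_card/properP; split.
  by apply/subsetP => x; rewrite !inE => /andP[-> /rel_trans ->].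
by exists u; rewrite inE uB ?uv ?rel_irr.
Qed.

(** Ranks are distinct and below [#|B|], hence take each of these values once. *)
Lemma card_select : #|Sel| = minn k #|B|.
Proof.
have rB u : u \in B -> (rank u < #|B|)%N.
  move=> uB; apply/proper_card/properP; split; first by apply/subsetP => x; rewrite inE => /andP[].
  by exists u => //; rewrite inE rel_irr andbF.
case: (posnP #|B|) => [B0|Bpos].
  rewrite B0 minn0; apply/eqP; rewrite cards_eq0 -subset0; apply/subsetP => u.
  by rewrite inE; move/eqP: B0; rewrite cards_eq0 => /eqP->; rewrite !inE.
pose r u : 'I_(#|B|.-1.+1) := inord (rank u).
have rE u : u \in B -> r u = rank u :> nat by move=> uB; rewrite inordK // prednK // rB.
have rinj : {in B &, injective r}.
  move=> u v uB vB /(congr1 val) /=; rewrite !rE // => e.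
  apply/eqP; apply: contraT => /rel_total/orP[/(rank_lt uB)|/(rank_lt vB)]; rewrite e ltnn //.
have rT : r @: B = setT.
  by apply/eqP; rewrite eqEcard subsetT /= card_in_imset // cardsT card_ord prednK.
have SB : Sel \subset B by apply/subsetP => u; rewrite inE => /andP[].
rewrite -(card_in_imset (sub_in2 (subsetP SB) rinj)).
have -> : r @: Sel = [set j : 'I_(#|B|.-1.+1) | (j < k)%N].
  apply/setP => j; rewrite inE; apply/imsetP/idP => [[u uS ->]|jk].
    by move: uS; rewrite inE => /andP[uB]; rewrite rE.
  have : j \in r @: B by rewrite rT inE.
  by case/imsetP=> u uB ej; exists u => //; rewrite inE uB -rE // -ej.
rewrite prednK // -sum1dep_card big_mkcond /=.
elim: #|B| => [|m IH]; first by rewrite big_ord0 minn0.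
by rewrite big_ord_recr /= IH; case: ifP; lia.
Qed.
End Rank.

Lemma card_preim_cells (I U : finType) (B : {set I}) (cell : I -> U) (X : {set U}) :
  #|[set u in B | cell u \in X]| = \sum_(c in X) #|[set u in B | cell u == c]|.
Proof.
rewrite -sum1dep_card (partition_big cell (fun c => c \in X)) /=; last by move=> u /andP[].
apply: eq_bigr => c cX; rewrite -sum1dep_card; apply: eq_bigl => u.
by case: (cell u =P c) => [->|_]; rewrite ?cX ?andbT ?andbF.
Qed.

Lemma select_max (I : finType) (lt : rel I) (B : {set I}) :
    irreflexive lt -> transitive lt -> (forall u v, u != v -> lt u v || lt v u) -> B != set0 ->
  exists2 w, w \in B & {in B, forall u, u != w -> lt u w}.
Proof.
move=> irr tr tot /set0Pn[u0 u0B].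
case: (arg_maxnP (fun u => #|[set v in B | lt v u]|) u0B) => w wB wmax.
exists w => // u uB /tot/orP[//|wu].
by have /= := wmax u uB; rewrite leqNgt (rank_lt irr tr wB wu).
Qed.

(** Exchange argument: outside the intersection, [t] separates the weights, and [X] has no more
    elements to trade than [R]. *)
Lemma sum_exchange_leq (U : finType) (X R : {set U}) (N : U -> nat) (t : nat) :
    (#|X| <= #|R|)%N -> {in R :\: X, forall c, (t <= N c)%N} -> {in X :\: R, forall c, (N c <= t)%N} ->
  (\sum_(c in X) N c <= \sum_(c in R) N c)%N.
Proof.
move=> le hR hX.
have hD : (#|X :\: R| <= #|R :\: X|)%N by rewrite !cardsD (setIC R); lia.
rewrite (big_setID R) [leqRHS](big_setID X) /= (setIC R) leq_add2l.
apply: (@leq_trans (\sum_(c in X :\: R) t)); first exact: leq_sum.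
apply: (@leq_trans (\sum_(c in R :\: X) t)); last exact: leq_sum.
by rewrite !sum_nat_const leq_mul2r hD orbT.
Qed.

(* [lt] lists the points cell by cell, the most populated cells first. *)
Lemma select_cells (I U : finType) (lt : rel I) (B S : {set I}) (cell : I -> U) (k : nat) :
    irreflexive lt -> transitive lt -> (forall u v, u != v -> lt u v || lt v u) ->
    (forall u v, #|[set x in B | cell x == cell u]| < #|[set x in B | cell x == cell v]| -> lt v u)%N ->
    (forall u v w, cell u = cell v -> cell w != cell u -> lt u w -> lt v w) ->
    S \subset B -> (k <= #|S|)%N ->
  (#|cell @: [set u in B | #|[set v in B | lt v u]| < k]| <= #|cell @: S|)%N.
Proof.
move=> irr tr tot ltN ltC /subsetP SB kS.
set Sel := [set u in B | _].
pose N c := #|[set x in B | cell x == c]|.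
have [->|Sel0] := eqVneq Sel set0; first by rewrite imset0 cards0.
have [w wSel wmax] := select_max irr tr tot Sel0.
have wB : w \in B by move: wSel; rewrite inE => /andP[].
have wk : (#|[set v in B | lt v w]| < k)%N by move: wSel; rewrite inE => /andP[].
have belowSel v : v \in B -> lt v w -> v \in Sel.
  by move=> vB vw; rewrite inE vB (ltn_trans (rank_lt irr tr vB vw)).
(* [w] is the last selected point. Its cell may be only partly selected, whereas every other cell
   met is selected entirely. *)
pose Full := [set u in Sel | cell u != cell w].
have FullB u : u \in Full -> u \in B by rewrite !inE => /andP[/andP[]].
have Fulllt u : u \in Full -> lt u w.
  rewrite inE => /andP[uS cu]; apply: wmax => //.
  by apply: contraNneq cu => ->.
have Fullk : (#|Full| < k)%N.
  apply: leq_ltn_trans wk; apply/subset_leq_card/subsetP => u uF.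
  by rewrite inE FullB // Fulllt.
rewrite leqNgt; apply/negP => card.
have {}card : (#|cell @: S| <= #|cell @: Full|)%N.
  rewrite -ltnS; apply: leq_trans card _.
  apply: (@leq_trans #|cell w |: cell @: Full|); last by rewrite cardsU1; case: (_ \notin _).
  apply/subset_leq_card/subsetP => _ /imsetP[u uS ->]; rewrite in_setU1.
  by case: eqP => //= /eqP h; apply: imset_f; rewrite inE uS h.
have hR : {in cell @: Full :\: cell @: S, forall c, (N (cell w) <= N c)%N}.
  move=> c /setDP[/imsetP[u uF ->] _]; rewrite leqNgt; apply/negP => /ltN wu.
  by have := tr _ _ _ wu (Fulllt _ uF); rewrite irr.
have hS : {in cell @: S :\: cell @: Full, forall c, (N c <= N (cell w))%N}.
  move=> c /setDP[/imsetP[u uS ->] cF]; rewrite leqNgt; apply/negP => lt1.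
  move/negP: cF; apply; apply: imset_f; rewrite inE belowSel ?SB ?ltN //=.
  by apply: contraTneq lt1 => ->; rewrite ltnn.
(* If [Sel] met more cells than [S], the cells of [S] would hold at most as many points as those of
   [Full]; but the former hold at least [k] points and the latter only [Full], fewer than [k]. *)
have := sum_exchange_leq card hR hS; rewrite -!card_preim_cells.
rewrite leqNgt => /negP; apply.
apply: leq_ltn_trans (_ : #|Full| < _)%N; last first.
  apply: leq_trans Fullk _; apply: leq_trans kS _.
  by apply/subset_leq_card/subsetP => u uS; rewrite inE SB // imset_f.
apply/subset_leq_card/subsetP => u; rewrite inE => /andP[uB /imsetP[v vF cuv]].
have cvw : cell w != cell v by move: vF; rewrite inE eq_sym => /andP[].
rewrite inE cuv eq_sym cvw andbT; apply: belowSel => //.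
by apply: ltC cvw (Fulllt _ vF).
Qed.

(** * The square-root budget *)

(** [q] is the finest subdivision to which [pigeonhole] applies with [g] cells and [i] points; the
    last bound makes [q + 1] at least [sqrt (i / g)]. *)
Lemma ex_sqrt_scale (g i : nat) : (0 < g)%N -> (g < i)%N ->
  exists q, [/\ (0 < q)%N, (g * q ^ 2 < i)%N & (i <= g * q.+1 ^ 2)%N].
Proof.
move=> g0 gi.
have ex : exists q, (i <= g * q.+1 ^ 2)%N by exists i; nia.
case: (ex_minnP ex) => q hq qmin; exists q; split=> //.
  by rewrite lt0n; apply: contraTneq hq => ->; rewrite muln1 -ltnNge.
case: q {hq} qmin => [|q] qmin; first by rewrite muln0 (leq_ltn_trans _ gi).
by rewrite ltnNge; apply/negP => /qmin; rewrite ltnn.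
Qed.

(* The increments in [i] are at least [c1 / (2 sqrt i)] for [i <= g], and at
   least [c2 / (2 sqrt i)]. *)
Definition budget (R : realType) (c1 c2 : R) (g i : nat) : R :=
  c1 * Num.sqrt (minn i g)%:R + c2 * Num.sqrt i%:R.

(** The difference is [1 / (sqrt (i + 1) + sqrt i)], and [r] bounds both roots; it will be the
    [q + 1] of [ex_sqrt_scale], possibly times [sqrt g]. *)
Lemma sqrt_diff_ge (R : realType) (i : nat) (r : R) : 0 < r -> i.+1%:R <= r ^+ 2 ->
  1 <= 2 * r * (Num.sqrt i.+1%:R - Num.sqrt i%:R).
Proof.
move=> r0 ir.
have := sqr_sqrtr (ler0n R i.+1); have := sqr_sqrtr (ler0n R i).
have := sqrtr_ge0 (i.+1%:R : R); have := sqrtr_ge0 (i%:R : R).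
have : Num.sqrt i.+1%:R <= r.
  by rewrite -(ger0_norm (ltW r0)) -sqrtr_sqr ler_wsqrtr.
have : Num.sqrt (i%:R : R) <= Num.sqrt i.+1%:R by rewrite ler_wsqrtr // ler_nat.
rewrite -natr1; move: (Num.sqrt (_ + 1)) (Num.sqrt _) => a b ba ar b0 a0 eb ea.
have : (a - b) * (a + b) = 1 by nra.
by nra.
Qed.

(** * The grid around a center *)

Section Grid.
Variables (R : realType) (n : nat) (P : 'I_n -> R * R) (p : 'I_n) (delta : R) (m : nat).
Hypotheses (delta0 : 0 <= delta) (m0 : (0 < m)%N) (mn : (m <= n)%N).

Definition ball := [set u : 'I_n | l1_dist (P p) (P u) <= delta].

(** Measured from the corner of the square. Scaling by [m] replaces the division of the side: in
    these coordinates a cell has side [delta + delta]. *)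
Definition gridx (u : 'I_n) := ((P u).1 - (P p).1 + delta) *+ m.
Definition gridy (u : 'I_n) := ((P u).2 - (P p).2 + delta) *+ m.

(** The cap is [n] rather than [m] because the machine counts thresholds in a loop of [n] rounds;
    [m <= n] keeps the ball within the capped range. *)
Definition cellx u := tcount n (delta + delta) (gridx u).
Definition celly u := tcount n (delta + delta) (gridy u).

Definition cell (u : 'I_n) : 'I_n.+1 * 'I_n.+1 := (inord (cellx u), inord (celly u)).

Lemma cell_eq u v : (cell u == cell v) = (cellx u == cellx v) && (celly u == celly v).
Proof. by rewrite xpair_eqE -!val_eqE /= !inordK // ltnS tcount_leq. Qed.

Lemma ball_coord u : u \in ball ->
  [/\ 0 <= (P u).1 - (P p).1 + delta <= delta + delta &
      0 <= (P u).2 - (P p).2 + delta <= delta + delta].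
Proof.
rewrite inE /l1_dist => h.
have h1 := normr_ge0 ((P p).1 - (P u).1); have h2 := normr_ge0 ((P p).2 - (P u).2).
have : `|(P p).1 - (P u).1| <= delta by lra.
have : `|(P p).2 - (P u).2| <= delta by lra.
by rewrite !ler_norml => /andP[? ?] /andP[? ?]; split; apply/andP; split; lra.
Qed.

Lemma grid_bounds u : u \in ball ->
  [/\ 0 <= gridx u, gridx u <= (delta + delta) *+ n,
      0 <= gridy u & gridy u <= (delta + delta) *+ n].
Proof.
have w0 : 0 <= delta + delta by rewrite addr_ge0.
move=> /ball_coord[/andP[x0 x1] /andP[y0 y1]]; rewrite /gridx /gridy !mulrn_wge0 //.
have le x : x <= delta + delta -> x *+ m <= (delta + delta) *+ n.
  by move=> h; apply: le_trans (ler_wpMn2l w0 mn); rewrite ler_wMn2r.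
by rewrite !le.
Qed.

Lemma far_cells u v : u \in ball -> v \in ball -> cell u != cell v ->
    (odd (cellx u), odd (celly u)) = (odd (cellx v), odd (celly v)) ->
  delta + delta <= l1_dist (P u) (P v) *+ m.
Proof.
have w0 : 0 <= delta + delta by rewrite addr_ge0.
have n0 : (0 < n)%N by apply: leq_trans m0 mn.
move=> uB vB; rewrite cell_eq negb_and => cuv [ox oy].
have [u1 u2 u3 u4] := grid_bounds uB; have [v1 v2 v3 v4] := grid_bounds vB.
(* Different indices of equal parity differ by at least two, which leaves a full cell between the
   points. *)
have far z z' : 0 <= z -> z <= (delta + delta) *+ n -> 0 <= z' -> z' <= (delta + delta) *+ n ->
    odd (tcount n (delta + delta) z) = odd (tcount n (delta + delta) z') ->
    tcount n (delta + delta) z != tcount n (delta + delta) z' -> delta + delta <= `|z - z'|.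
  move=> h1 h2 h3 h4 eo ne.
  have [h|h|h] := ltngtP (tcount n (delta + delta) z) (tcount n (delta + delta) z').
  - rewrite distrC; apply: le_trans (ler_norm _); apply: tcount_far h1 h2 h3 h4 _ => //.
    by move: h; rewrite leq_eqVlt => /orP[/eqP e|//]; move: eo; rewrite -e /=; case: odd.
  - apply: le_trans (ler_norm _); apply: tcount_far h3 h4 h1 h2 _ => //.
    by move: h; rewrite leq_eqVlt => /orP[/eqP e|//]; move: eo; rewrite -e /=; case: odd.
  - by rewrite h eqxx in ne.
have dx : `|gridx u - gridx v| = `|(P u).1 - (P v).1| *+ m.
  by rewrite -normrMn /gridx -mulrnBl; congr (`|_ *+ _|); ring.
have dy : `|gridy u - gridy v| = `|(P u).2 - (P v).2| *+ m.
  by rewrite -normrMn /gridy -mulrnBl; congr (`|_ *+ _|); ring.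
rewrite /l1_dist mulrnDl -dx -dy; case/orP: cuv => ne.
  by rewrite -[leLHS]addr0 lerD // far.
by rewrite -[leLHS]add0r lerD // far.
Qed.

Lemma close_pair_ball (A : {set 'I_n}) (q : nat) : A \subset ball -> (0 < q)%N -> (q ^ 2 < #|A|)%N ->
  exists u v, [/\ u \in A, v \in A, u != v & l1_dist (P u) (P v) *+ q <= 4 * delta].
Proof.
move=> /subsetP AB q0 qA.
have w0 : 0 <= delta + delta by rewrite addr_ge0.
(* The constant map makes the whole square a single cell. *)
have card : (#|[set tt | u in A]| * q ^ 2 < #|A|)%N.
  by apply: leq_ltn_trans qA; rewrite -[leqRHS]mul1n leq_mul2r -card_unit max_card orbT.
have [] := @pigeonhole R _ unit A (fun=> tt) q (delta + delta)
  (fun u => (P u).1 - (P p).1 + delta) (fun u => (P u).2 - (P p).2 + delta) q0 w0 _ _ card.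
- by move=> u /AB/ball_coord[].
- by move=> u /AB/ball_coord[].
move=> u [v [uA vA uv _ [hx hy]]]; exists u, v; split=> //.
have e a b c d : (a - b + c) - (d - b + c) = a - d :> R by ring.
by move: hx hy; rewrite !e /l1_dist mulrnDl => hx hy; lra.
Qed.

Lemma close_pair_cells (A : {set 'I_n}) (q : nat) : A \subset ball -> (0 < q)%N ->
    (#|cell @: A| * q ^ 2 < #|A|)%N ->
  exists u v, [/\ u \in A, v \in A, u != v & l1_dist (P u) (P v) *+ m *+ q <= 4 * delta].
Proof.
move=> /subsetP AB q0 qA.
have w0 : 0 <= delta + delta by rewrite addr_ge0.
have n0 : (0 < n)%N by apply: leq_trans m0 mn.
(* Offsets from the corner of the cell: two points of one cell subtract the same multiple, so their
   offsets differ as their coordinates do. *)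
have off z : 0 <= z -> z <= (delta + delta) *+ n ->
    0 <= z - (delta + delta) *+ (tcount n (delta + delta) z).-1 <= delta + delta.
  move=> h1 h2; have [c0 h3 h4] := tcount_bounds n0 w0 h1 h2.
  rewrite -(prednK c0) mulrS in h4; apply/andP; split; lra.
have [] := @pigeonhole R _ _ A cell q (delta + delta)
  (fun u => gridx u - (delta + delta) *+ (cellx u).-1)
  (fun u => gridy u - (delta + delta) *+ (celly u).-1) q0 w0 _ _ qA.
- by move=> u /AB/grid_bounds[? ? ? ?]; apply: off.
- by move=> u /AB/grid_bounds[? ? ? ?]; apply: off.
move=> u [v [uA vA uv /eqP]]; rewrite cell_eq => /andP[/eqP-> /eqP->] [hx hy].
exists u, v; split=> //.
have e z z' c : (z - c) - (z' - c) = z - z' :> R by ring.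
have e2 a b c d : (a - b + c) *+ m - (d - b + c) *+ m = (a - d) *+ m :> R.
  by rewrite -mulrnBl; congr (_ *+ _); ring.
move: hx hy; rewrite !e /gridx /gridy !e2 !normrMn /l1_dist !mulrnDl => hx hy; lra.
Qed.

(** A closest pair is within [4 * delta / q], and the square root grows by at least
    [1 / (2 * (q + 1)) >= 1 / (4 * q)]: hence 16. Inside cells the distance is [m] times smaller,
    but [q] is only about [sqrt (i / g)]: hence the factor [sqrt g / m]. *)
Definition grid_budget (g i : nat) : R :=
  budget (16 * delta) (16 * delta * Num.sqrt g%:R / m%:R) g i.

(** For [i < g] the first term of the budget grows and pays for the bound in the whole ball; for
    [i >= g] it is constant, and the second term pays for the bound inside cells. *)
Lemma close_pair_budget (A : {set 'I_n}) (g i : nat) : A \subset ball ->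
    (0 < i)%N -> #|A| = i.+1 -> (#|cell @: A| <= g)%N ->
  exists u v, [/\ u \in A, v \in A, u != v &
    l1_dist (P u) (P v) <= grid_budget g i.+1 - grid_budget g i].
Proof.
move=> AB i0 Ai cg.
have mR : 0 < m%:R :> R by rewrite ltr0n.
have g0 : (0 < g)%N.
  apply: leq_trans cg; rewrite card_gt0; apply/set0Pn.
  have : A != set0 by rewrite -card_gt0 Ai.
  by case/set0Pn=> u uA; exists (cell u); apply: imset_f.
pose G := Num.sqrt (g%:R : R).
have G0 : 0 < G by rewrite sqrtr_gt0 ltr0n.
have GG : G ^+ 2 = g%:R by rewrite sqr_sqrtr ?ler0n.
have mono : Num.sqrt (i%:R : R) <= Num.sqrt i.+1%:R by rewrite ler_wsqrtr // ler_nat.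
have diff r : 0 < r -> i.+1%:R <= r ^+ 2 -> 1 <= 2 * r * (Num.sqrt i.+1%:R - Num.sqrt i%:R) :> R.
  exact: sqrt_diff_ge.
rewrite /grid_budget /budget -/G.
have c20 : 0 <= 16 * delta * G / m%:R.
  by rewrite !mulr_ge0 ?invr_ge0 // ltW.
have [ig|gi] := ltnP i g.
  have [q [q0 q1 q2]] := ex_sqrt_scale (isT : (0 < 1)%N) (i0 : (1 < i.+1)%N).
  rewrite !mul1n in q1 q2.
  have [u [v [uA vA uv duv]]] := close_pair_ball AB q0 (etrans (congr1 _ Ai) q1).
  exists u, v; split=> //.
  have -> : minn i.+1 g = i.+1 by lia.
  have := diff q.+1%:R; rewrite ltr0n -natrX ler_nat q2 => /(_ isT isT).
  have : 1 <= q%:R :> R by rewrite ler1n.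
  rewrite -(natr1 q); move: duv mono; rewrite -(mulr_natr (l1_dist _ _)).
  move: (l1_dist _ _) (Num.sqrt i%:R) (Num.sqrt i.+1%:R) (q%:R : R) c20 => d a b r.
  move: (_ / _) => c c0 dr ab r1 h.
  have h3 : 0 <= c * (b - a) by rewrite mulr_ge0 // subr_ge0.
  have h4 : 4 * delta <= 16 * delta * (b - a) * r.
    (* Here [r] is [q], and [q + 1 <= 2 * q] turns the factor 2 of [sqrt_diff_ge] into 4. *)
    have p0 : 0 <= (b - a) * (r - 1) by rewrite mulr_ge0 // subr_ge0.
    have p1 : 0 <= 4 * ((b - a) * r) - 1 by lra.
    have p2 := mulr_ge0 delta0 p1; lra.
  have h5 : d <= 16 * delta * (b - a) by rewrite -(ler_pM2r (lt_le_trans ltr01 r1)); apply: le_trans h4.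
  by lra.
have [q [q0 q1 q2]] := ex_sqrt_scale g0 (gi : (g < i.+1)%N).
have q1' : (#|cell @: A| * q ^ 2 < #|A|)%N.
  by rewrite Ai; apply: leq_ltn_trans q1; rewrite leq_mul2r cg orbT.
have [u [v [uA vA uv duv]]] := close_pair_cells AB q0 q1'.
exists u, v; split=> //.
have -> : minn i.+1 g = g by lia.
have := diff (G * q.+1%:R); rewrite mulr_gt0 ?ltr0n // exprMn GG -natrX -natrM ler_nat q2 => /(_ isT isT).
have : 1 <= q%:R :> R by rewrite ler1n.
rewrite -(natr1 q); move: duv mono; rewrite -mulrnA -(mulr_natr (l1_dist _ _)) natrM.
move: (l1_dist _ _) (Num.sqrt i%:R) (Num.sqrt i.+1%:R) (q%:R : R) => d a b r dr ab r1 h.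
have h4 : 4 * delta <= 16 * delta * G * (b - a) * r.
  have p0 : 0 <= G * (b - a) * (r - 1) by rewrite !mulr_ge0 ?subr_ge0 // ltW.
  have p1 : 0 <= 4 * (G * (b - a) * r) - 1 by lra.
  have p2 := mulr_ge0 delta0 p1; lra.
rewrite [leRHS](_ : _ = 16 * delta * G / m%:R * (b - a)); last by ring.
rewrite -(ler_pM2r (_ : 0 < m%:R * r)); last first.
  by rewrite mulr_gt0 // (lt_le_trans ltr01).
apply: (le_trans dr); apply: (le_trans h4).
by rewrite le_eqVlt; apply/orP; left; apply/eqP; field; rewrite lt0r_neq0.
Qed.

(** Distinct cells of one parity class are [2 * delta / m] apart; clearing this factor turns the 8
    of [cells_le_rect_length] into [4 * m]. *)
Lemma cells_tree S E : is_connected S E -> p \in S -> S \subset ball ->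
    delta <= rect_length P E ->
  #|cell @: S|%:R * delta <= 4 * m%:R * rect_length P E.
Proof.
move=> cSE pS /subsetP SB dL.
have mR : 0 < m%:R :> R by rewrite ltr0n.
have m1 : 1 <= m%:R :> R by rewrite ler1n.
pose par (c : 'I_n.+1 * 'I_n.+1) := (odd c.1, odd c.2).
have w0 : 0 <= delta + delta by rewrite addr_ge0.
have s0 : 0 <= (delta + delta) / m%:R by rewrite mulr_ge0 // invr_ge0 ltW.
have sL : (delta + delta) / m%:R <= 2 * rect_length P E.
  by rewrite ler_pdivrMr //; nra.
have := cells_le_rect_length (par := par) cSE s0 sL.
have far : {in S &, forall u v, cell u != cell v -> par (cell u) = par (cell v) ->
    (delta + delta) / m%:R <= l1_dist (P u) (P v)}.
  move=> u v /SB uB /SB vB cuv; rewrite /par /= !inordK ?ltnS ?tcount_leq // => e.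
  by rewrite ler_pdivrMr // mulr_natr; apply: far_cells.
move=> /(_ _ far); rewrite mulrA ler_pdivrMr // => h; lra.
Qed.

(** From [delta ^ 2 * g <= 4 * m * L ^ 2 <= 8 * r ^ 2 * L ^ 2] one gets
    [delta * sqrt g <= 3 * r * L]. Both terms of the budget are at most [16 * delta * sqrt g], the
    second because [sqrt k <= m]: hence 96. *)
Lemma grid_budget_le (g k : nat) (r L : R) : (k <= m ^ 2)%N -> (m ^ 2 <= 4 * k)%N ->
    0 <= r -> r ^+ 4 = k%:R -> 0 <= L -> delta <= L -> g%:R * delta <= 4 * m%:R * L ->
  grid_budget g k <= 96 * r * L.
Proof.
move=> km mk r0 rk L0 dL gL.
have mR : 0 < m%:R :> R by rewrite ltr0n.
pose G := Num.sqrt (g%:R : R).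
have G0 : 0 <= G by rewrite sqrtr_ge0.
have GG : G ^+ 2 = g%:R by rewrite sqr_sqrtr ?ler0n.
have mr : m%:R <= 2 * r ^+ 2.
  rewrite -(ler_pXn2r (n := 2)) ?nnegrE ?mulr_ge0 ?exprn_ge0 // ?ler0n //.
  have -> : (2 * r ^+ 2) ^+ 2 = 4 * r ^+ 4 by ring.
  by rewrite rk -natrX -natrM ler_nat.
have dG : delta * G <= 3 * r * L.
  rewrite -(ler_pXn2r (n := 2)) ?nnegrE ?mulr_ge0 //.
  rewrite !exprMn GG.
  have : delta * (g%:R * delta) <= L * (4 * m%:R * L).
    by rewrite ler_pM // mulr_ge0.
  have : L * (4 * m%:R * L) <= L * (4 * (2 * r ^+ 2) * L).
    by rewrite ler_wpM2l // ler_wpM2r // ler_wpM2l.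
  have : 0 <= r ^+ 2 * L ^+ 2 by rewrite mulr_ge0 ?exprn_ge0.
  by nra.
have minG : Num.sqrt (minn k g)%:R <= G by rewrite ler_wsqrtr // ler_nat geq_minr.
have kM : Num.sqrt k%:R <= m%:R :> R.
  by rewrite -(ger0_norm (ltW mR)) -sqrtr_sqr ler_wsqrtr // -natrX ler_nat.
have h1 : 16 * delta * Num.sqrt (minn k g)%:R <= 16 * delta * G by rewrite ler_wpM2l // mulr_ge0.
have h2 : 16 * delta * G / m%:R * Num.sqrt k%:R <= 16 * delta * G.
  rewrite -mulrA -[leRHS]mulr1 ler_wpM2l ?mulr_ge0 //.
  by rewrite mulrC ler_pdivrMr // mul1r.
by rewrite /grid_budget /budget -/G; lra.
Qed.

End Grid.

(** * The program *)

Arguments sem : simpl never.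
Arguments update A m a i x b j /.

(* Names of the arrays of naturals ([v...]) and of reals ([r...]); the input and
   output arrays are designated by their numbers. *)
Local Notation vP := 5%N.
Local Notation vQ := 6%N.
Local Notation vU := 7%N.
Local Notation vV := 8%N.
Local Notation vJ := 9%N.
Local Notation vM := 10%N.
Local Notation vSq := 11%N.
Local Notation vBall := 12%N.
Local Notation vCx := 13%N.
Local Notation vCy := 14%N.
Local Notation vCnt := 15%N.
Local Notation vRank := 16%N.
Local Notation vSel := 17%N.
Local Notation vTot := 18%N.
Local Notation vAct := 19%N.
Local Notation vA := 20%N.
Local Notation vB := 21%N.
Local Notation vNe := 22%N.
Local Notation vBu := 23%N.
Local Notation vBv := 24%N.
Local Notation vFound := 25%N.
Local Notation vHave := 26%N.
Local Notation vR := 27%N.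
Local Notation rD := 2%N.
Local Notation rDelta := 3%N.
Local Notation rZx := 4%N.
Local Notation rZy := 5%N.
Local Notation rTh := 6%N.
Local Notation rBest := 7%N.
Local Notation rLen := 8%N.
Local Notation rBestLen := 9%N.

Definition cellR (a : nat) : real_expr := RGet a (NConst 0).
Definition NLt e1 e2 := NLe (NAdd e1 (NConst 1)) e2.
Definition NEq e1 e2 := TAnd (NLe e1 e2) (NLe e2 e1).
Definition TOr b1 b2 := TNot (TAnd (TNot b1) (TNot b2)).
Definition NTrue a e := NLe (NConst 1) (NGet a e).
Definition setc a c := PN a (NConst 0) (NConst c).
Definition inc a e := PN a e (incr a e).

Definition dist_prog (eu ev : nat_expr) : prog :=
  PSeq
    (PIf (RLe (RGet 0 eu) (RGet 0 ev))
       (PR rD (NConst 0) (RSub (RGet 0 ev) (RGet 0 eu)))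
       (PR rD (NConst 0) (RSub (RGet 0 eu) (RGet 0 ev))))
    (PIf (RLe (RGet 1 eu) (RGet 1 ev))
       (PR rD (NConst 0) (RAdd (cellR rD) (RSub (RGet 1 ev) (RGet 1 eu))))
       (PR rD (NConst 0) (RAdd (cellR rD) (RSub (RGet 1 eu) (RGet 1 ev))))).

(** [vSq] follows the square of [vM] by [(m + 1) ^ 2 = m ^ 2 + m + (m + 1)], without multiplication,
    until it reaches [k]. *)
Definition grid_size_prog : prog :=
  PSeq (setc vM 0) (PSeq (setc vSq 0)
    (PFor vJ (PIf (NLt (cell0 vSq) (NGet 0 (NConst 1)))
      (PSeq (PN vSq (NConst 0) (NAdd (cell0 vSq) (NAdd (cell0 vM) (incr vM (NConst 0)))))
            (inc vM (NConst 0)))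
      PSkip))).

Definition ball_prog : prog :=
  PSeq (dist_prog (cell0 vP) (cell0 vQ))
  (PSeq (PR rDelta (NConst 0) (cellR rD))
    (PFor vU (PSeq (dist_prog (cell0 vP) (cell0 vU))
      (PIf (RLe (cellR rD) (cellR rDelta))
         (PN vBall (cell0 vU) (NConst 1)) (PN vBall (cell0 vU) (NConst 0)))))).

(** Multiplication by [m] as repeated addition: of the [n] rounds only the first [m] act. *)
Definition scale_prog : prog :=
  PFor vJ (PIf (NLt (cell0 vJ) (cell0 vM))
    (PSeq (PR rZx (NConst 0) (RAdd (cellR rZx)
             (RAdd (RSub (RGet 0 (cell0 vU)) (RGet 0 (cell0 vP))) (cellR rDelta))))
          (PR rZy (NConst 0) (RAdd (cellR rZy)
             (RAdd (RSub (RGet 1 (cell0 vU)) (RGet 1 (cell0 vP))) (cellR rDelta)))))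
    PSkip).

(** [rTh] runs through the multiples of [delta + delta], so the thresholds are counted as in
    [tcount]. *)
Definition index_prog : prog :=
  PFor vJ
    (PSeq (PIf (RLe (cellR rTh) (cellR rZx)) (inc vCx (cell0 vU)) PSkip)
    (PSeq (PIf (RLe (cellR rTh) (cellR rZy)) (inc vCy (cell0 vU)) PSkip)
          (PR rTh (NConst 0) (RAdd (cellR rTh) (RAdd (cellR rDelta) (cellR rDelta)))))).

Definition cells_prog : prog :=
  PFor vU
    (PSeq (PN vCx (cell0 vU) (NConst 0)) (PSeq (PN vCy (cell0 vU) (NConst 0))
    (PSeq (PR rZx (NConst 0) (RConst 0)) (PSeq (PR rZy (NConst 0) (RConst 0))
    (PSeq (PR rTh (NConst 0) (RConst 0))
    (PSeq scale_prog index_prog)))))).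

Definition same_test (eu ev : nat_expr) : test :=
  TAnd (NEq (NGet vCx eu) (NGet vCx ev)) (NEq (NGet vCy eu) (NGet vCy ev)).

Definition counts_prog : prog :=
  PFor vU
    (PSeq (PN vCnt (cell0 vU) (NConst 0))
      (PFor vV (PIf (TAnd (NTrue vBall (cell0 vV)) (same_test (cell0 vV) (cell0 vU)))
         (inc vCnt (cell0 vU)) PSkip))).

(** Population comes first, so that the fullest cells are exhausted first; then the coordinates, so
    that equally populated cells are not interleaved; then the index, which makes the order
    total. *)
Definition before_test (ev eu : nat_expr) : test :=
  TOr (NLt (NGet vCnt eu) (NGet vCnt ev)) (TAnd (NEq (NGet vCnt eu) (NGet vCnt ev))
  (TOr (NLt (NGet vCx ev) (NGet vCx eu)) (TAnd (NEq (NGet vCx ev) (NGet vCx eu))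
  (TOr (NLt (NGet vCy ev) (NGet vCy eu)) (TAnd (NEq (NGet vCy ev) (NGet vCy eu))
  (NLt ev eu)))))).

(** [vAct] starts as a copy of [vSel]: it is consumed while the tree is built, whereas [vSel] is
    kept for the output. *)
Definition select_prog : prog :=
  PSeq (setc vTot 0)
  (PFor vU
    (PSeq (setc vRank 0)
    (PSeq (PFor vV (PIf (TAnd (NTrue vBall (cell0 vV)) (before_test (cell0 vV) (cell0 vU)))
                      (inc vRank (NConst 0)) PSkip))
    (PIf (TAnd (NTrue vBall (cell0 vU)) (NLt (cell0 vRank) (NGet 0 (NConst 1))))
       (PSeq (PN vSel (cell0 vU) (NConst 1)) (PSeq (PN vAct (cell0 vU) (NConst 1))
             (inc vTot (NConst 0))))
       (PSeq (PN vSel (cell0 vU) (NConst 0)) (PN vAct (cell0 vU) (NConst 0))))))).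

Definition pair_prog : prog :=
  PSeq (setc vFound 0)
  (PFor vU (PFor vV
    (PIf (TAnd (NTrue vAct (cell0 vU)) (TAnd (NTrue vAct (cell0 vV)) (NLt (cell0 vU) (cell0 vV))))
      (PSeq (dist_prog (cell0 vU) (cell0 vV))
        (PIf (TOr (TNot (NTrue vFound (NConst 0))) (RLe (cellR rD) (cellR rBest)))
          (PSeq (PR rBest (NConst 0) (cellR rD))
          (PSeq (PN vBu (NConst 0) (cell0 vU))
          (PSeq (PN vBv (NConst 0) (cell0 vV))
                (setc vFound 1))))
          PSkip))
      PSkip))).

(** Fewer than [n] joins are possible; the remaining rounds find no pair and add no edge. *)
Definition span_prog : prog :=
  PSeq (setc vNe 0)
  (PSeq (PR rLen (NConst 0) (RConst 0))
  (PFor vR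
    (PSeq pair_prog
      (PIf (NTrue vFound (NConst 0))
        (PSeq (PN vA (cell0 vNe) (cell0 vBu))
        (PSeq (PN vB (cell0 vNe) (cell0 vBv))
        (PSeq (inc vNe (NConst 0))
        (PSeq (PR rLen (NConst 0) (RAdd (cellR rLen) (cellR rBest)))
              (PN vAct (cell0 vBu) (NConst 0))))))
        PSkip)))).

Definition vertices_prog : prog :=
  PSeq (PN 1 (NConst 0) (NConst 0))
  (PFor vU (PIf (NTrue vSel (cell0 vU))
    (PSeq (PN 2 (NGet 1 (NConst 0)) (cell0 vU)) (inc 1 (NConst 0))) PSkip)).

(** All [n] cells are copied; only the first [vNe] count as output. *)
Definition edges_prog : prog :=
  PSeq (PN 1 (NConst 1) (cell0 vNe))
  (PFor vJ (PSeq (PN 3 (cell0 vJ) (NGet vA (cell0 vJ)))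
                 (PN 4 (cell0 vJ) (NGet vB (cell0 vJ))))).

(** [vTot] is smaller than [k] exactly when the ball holds fewer than [k] points; such centers are
    skipped. *)
Definition record_prog : prog :=
  PIf (TAnd (NLe (NGet 0 (NConst 1)) (cell0 vTot))
         (TOr (TNot (NTrue vHave (NConst 0))) (RLe (cellR rLen) (cellR rBestLen))))
    (PSeq (setc vHave 1)
    (PSeq (PR rBestLen (NConst 0) (cellR rLen))
    (PSeq vertices_prog edges_prog)))
    PSkip.

Definition pair_of_centers_prog : prog :=
  PSeq ball_prog (PSeq cells_prog (PSeq counts_prog (PSeq select_prog (PSeq span_prog record_prog)))).

Definition k_tree_prog : prog :=
  PSeq grid_size_prog (PSeq (setc vHave 0) (PFor vP (PFor vQ pair_of_centers_prog))).

Lemma wf_k_tree_prog : wf k_tree_prog.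
Proof. by []. Qed.

Section Evaluation.
Variable R : realType.
Implicit Types s t : memory R.

Lemma sem_skip s : sem PSkip s = s. Proof. by []. Qed.
Lemma sem_n s a i e : sem (PN a i e) s = setn s a (neval s i) (neval s e). Proof. by []. Qed.
Lemma sem_r s a i e : sem (PR a i e) s = setr s a (neval s i) (reval s e). Proof. by []. Qed.
Lemma sem_seq s p q : sem (PSeq p q) s = sem q (sem p s). Proof. by []. Qed.
Lemma sem_if s b p q : sem (PIf b p q) s = if teval s b then sem p s else sem q s.
Proof. by []. Qed.
Lemma teval_NLt s e1 e2 : teval s (NLt e1 e2) = (neval s e1 < neval s e2)%N.
Proof. by rewrite /= addn1. Qed.
Lemma teval_NEq s e1 e2 : teval s (NEq e1 e2) = (neval s e1 == neval s e2).
Proof. by rewrite /= eqn_leq. Qed.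
Lemma teval_TOr s b1 b2 : teval s (TOr b1 b2) = teval s b1 || teval s b2.
Proof. by rewrite /= negb_and !negbK. Qed.

Definition pt s (u : nat) : R * R := (rmem s 0 u, rmem s 1 u).

Lemma dist_progP s eu ev :
  [/\ nmem (sem (dist_prog eu ev) s) = nmem s,
      rmem (sem (dist_prog eu ev) s) rD 0 = l1_dist (pt s (neval s eu)) (pt s (neval s ev)) &
      forall a j, a != rD -> rmem (sem (dist_prog eu ev) s) a j = rmem s a j].
Proof.
have frame a j : a != rD -> rmem (sem (dist_prog eu ev) s) a j = rmem s a j.
  by move=> h; rewrite rframe //= !inE !(negPf h).
split=> //.
  by rewrite /dist_prog sem_seq sem_if; case: ifP => _; rewrite sem_if; case: ifP.
have nE (u : nat_expr) x : neval (setr s rD 0 x) u = neval s u.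
  by elim: u => //= [a e -> //|e1 -> e2 ->|e1 -> e2 ->].
have ab (x y : R) : `|x - y| = if x <= y then y - x else x - y.
  by case: lerP.
rewrite /l1_dist !ab /dist_prog sem_seq.
have -> : sem (PIf (RLe (RGet 0 eu) (RGet 0 ev))
       (PR rD (NConst 0) (RSub (RGet 0 ev) (RGet 0 eu)))
       (PR rD (NConst 0) (RSub (RGet 0 eu) (RGet 0 ev)))) s =
   setr s rD 0 (if rmem s 0 (neval s eu) <= rmem s 0 (neval s ev)
  then rmem s 0 (neval s ev) - rmem s 0 (neval s eu)
  else rmem s 0 (neval s eu) - rmem s 0 (neval s ev)).
  by rewrite sem_if /=; case: ifP.
by rewrite sem_if /= !nE; case: ifP => _; rewrite sem_r /= !nE.
Qed.

End Evaluation.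

(** * Correctness of the program *)

Section Loops.
Variable R : realType.
Implicit Types s t : memory R.

(** The common shape of the loops that compute populations and ranks. *)
Lemma sem_count s i b c e (f : nat -> bool) x :
    wf (PFor i (PIf b (inc c e) PSkip)) ->
    (forall j t, (j < nmem s 0 0)%N -> nmem t i 0 = j ->
       (forall a y, a \notin [:: i; c] -> nmem t a y = nmem s a y) ->
       teval t b = f j /\ neval t e = x) ->
  let s' := sem (PFor i (PIf b (inc c e) PSkip)) s in
  nmem s' c x = (nmem s c x + \sum_(j < nmem s 0 0) f j)%N /\
  forall y, y != x -> nmem s' c y = nmem s c y.
Proof.
move=> w H s'.
apply: (sem_for (Inv := fun j t => nmem t c x = (nmem s c x + \sum_(v < j) f v)%N /\
   forall y, y != x -> nmem t c y = nmem s c y) w).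
  have ci : (c == i) = false by move: w; rewrite /= !inE => /and3P[_ h _]; rewrite eq_sym; apply: negPf.
  by split=> [|y _]; rewrite /= ci //= big_ord0 addn0.
move=> j t jn ti fr _ [IH1 IH2].
have ci : (c == i) = false by move: w; rewrite /= !inE => /and3P[_ h _]; rewrite eq_sym; apply: negPf.
have [hb he] := H j t jn ti fr.
rewrite sem_if hb big_ord_recr /= addnA -IH1.
case: (f j); rewrite ?sem_n ?sem_skip; split=> [|y yx] /=; rewrite ci /= ?he ?eqxx ?addn1 //.
- by rewrite /= (negPf yx) IH2.
- by rewrite addn0.
- exact: IH2.
Qed.

Definition inb s (v : nat) := (0 < nmem s vBall v)%N.
Definition same s (v u : nat) := (nmem s vCx v == nmem s vCx u) && (nmem s vCy v == nmem s vCy u).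

Lemma counts_progP s u : (u < nmem s 0 0)%N ->
  nmem (sem counts_prog s) vCnt u = (\sum_(v < nmem s 0 0) (inb s v && same s v u))%N.
Proof.
move: u; apply: (sem_for (Inv := fun j t => forall u, (u < j)%N ->
  nmem t vCnt u = (\sum_(v < nmem s 0 0) (inb s v && same s v u))%N)) => //.
move=> j t jn tj fr _ IH u; rewrite ltnS leq_eqVlt => uj.
rewrite sem_seq sem_n /= tj.
have n_eq : nmem (setn t vCnt j 0) 0 0 = nmem s 0 0 by rewrite /= fr.
have [] := @sem_count (setn t vCnt j 0) vV (TAnd (NTrue vBall (cell0 vV)) (same_test (cell0 vV) (cell0 vU)))
   vCnt (cell0 vU) (fun v => inb s v && same s v j) j isT.
  move=> v t' vn tv fr'; rewrite /= tv !fr' //= tj !fr //; split=> //.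
  by rewrite /inb /same !eqn_leq.
rewrite n_eq => h1 h2; case/orP: uj => [/eqP->|uj].
  by rewrite h1 /= eqxx add0n.
have uj' : u != j by rewrite neq_ltn uj.
by rewrite h2 // /= (negPf uj') IH.
Qed.

Lemma ball_progP s : let d0 := l1_dist (pt s (nmem s vP 0)) (pt s (nmem s vQ 0)) in
  rmem (sem ball_prog s) rDelta 0 = d0 /\
  forall u, (u < nmem s 0 0)%N ->
    nmem (sem ball_prog s) vBall u = (l1_dist (pt s (nmem s vP 0)) (pt s u) <= d0)%R.
Proof.
move=> d0; rewrite /ball_prog !sem_seq sem_r.
have [n1 d1 r1] := dist_progP s (cell0 vP) (cell0 vQ).
set s1 := sem (dist_prog _ _) s in n1 d1 r1 *.
set s2 := setr s1 rDelta _ _.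
have d2 : rmem s2 rDelta 0 = d0 by [].
have n2 : nmem s2 = nmem s by [].
split; first by rewrite rframe.
rewrite -{1}n2; apply: (sem_for (Inv := fun j t => forall u, (u < j)%N ->
  nmem t vBall u = (l1_dist (pt s (nmem s vP 0)) (pt s u) <= d0)%R)) => //.
move=> j t jn tj fr fr' IH u; rewrite ltnS leq_eqVlt => uj.
have [nt dt rt] := dist_progP t (cell0 vP) (cell0 vU).
have ptE v : pt t v = pt s v by rewrite /pt !fr' //= !r1.
rewrite /= tj fr // n2 !ptE in dt.
rewrite sem_seq sem_if /= dt rt // fr' // d2 -/d0.
case/orP: uj => [/eqP->|uj].
  by case: ifP => _; rewrite sem_n /= nt tj eqxx.
have uj' : u != j by rewrite neq_ltn uj.
by case: ifP => _; rewrite sem_n /= nt tj (negPf uj') IH.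
Qed.

Lemma scale_progP s : (nmem s vM 0 <= nmem s 0 0)%N ->
  let u := nmem s vU 0 in let p := nmem s vP 0 in
  rmem (sem scale_prog s) rZx 0 =
    rmem s rZx 0 + (rmem s 0 u - rmem s 0 p + rmem s rDelta 0) *+ nmem s vM 0 /\
  rmem (sem scale_prog s) rZy 0 =
    rmem s rZy 0 + (rmem s 1 u - rmem s 1 p + rmem s rDelta 0) *+ nmem s vM 0.
Proof.
move=> mn u p.
(* After [j] rounds [minn j m] of them have acted; the goal is put in this form for [j = n]. *)
have : minn (nmem s 0 0) (nmem s vM 0) = nmem s vM 0 by lia.
set m := nmem s vM 0 => <-.
apply: (sem_for (Inv := fun j t =>
  rmem t rZx 0 = rmem s rZx 0 + (rmem s 0 u - rmem s 0 p + rmem s rDelta 0) *+ minn j m /\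
  rmem t rZy 0 = rmem s rZy 0 + (rmem s 1 u - rmem s 1 p + rmem s rDelta 0) *+ minn j m)) => //.
  by rewrite /= min0n !mulr0n !addr0.
move=> j t jn tj fr fr' [IH1 IH2].
rewrite sem_if teval_NLt /= tj (fr vM) // -/m.
case: ltnP => jm.
  rewrite sem_seq !sem_r /= IH1 IH2 !fr // !fr' // -/u -/p.
  have -> : minn j.+1 m = (minn j m).+1 by lia.
  have -> : minn j m = j by lia.
  by rewrite !mulrSr !addrA.
have -> : minn j.+1 m = minn j m by lia.
by rewrite sem_skip.
Qed.

Lemma index_progP s : rmem s rTh 0 = 0 ->
  let w := rmem s rDelta 0 + rmem s rDelta 0 in let u := nmem s vU 0 in
  (nmem (sem index_prog s) vCx u = nmem s vCx u + tcount (nmem s 0 0) w (rmem s rZx 0))%N /\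
  (nmem (sem index_prog s) vCy u = nmem s vCy u + tcount (nmem s 0 0) w (rmem s rZy 0))%N /\
  forall v, v != u -> nmem (sem index_prog s) vCx v = nmem s vCx v /\
                      nmem (sem index_prog s) vCy v = nmem s vCy v.
Proof.
move=> th0 w u.
have tS z j : tcount j.+1 w z = (tcount j w z + (w *+ j <= z)%R)%N.
  by rewrite /tcount big_ord_recr.
(* The invariant has to carry the current threshold as well. *)
suff [_ //] : (rmem (sem index_prog s) rTh 0 = w *+ nmem s 0 0) /\
  (nmem (sem index_prog s) vCx u = nmem s vCx u + tcount (nmem s 0 0) w (rmem s rZx 0))%N /\
  (nmem (sem index_prog s) vCy u = nmem s vCy u + tcount (nmem s 0 0) w (rmem s rZy 0))%N /\
  forall v, v != u -> nmem (sem index_prog s) vCx v = nmem s vCx v /\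
                      nmem (sem index_prog s) vCy v = nmem s vCy v.
apply: (sem_for (Inv := fun j t =>
  (rmem t rTh 0 = w *+ j) /\
  (nmem t vCx u = nmem s vCx u + tcount j w (rmem s rZx 0))%N /\
  (nmem t vCy u = nmem s vCy u + tcount j w (rmem s rZy 0))%N /\
  forall v, v != u -> nmem t vCx v = nmem s vCx v /\ nmem t vCy v = nmem s vCy v)) => //.
  by rewrite /= th0 mulr0n /tcount !big_ord0 !addn0.
move=> j t jn tj fr fr' [IH1 [IH2 [IH3 IH4]]].
rewrite !sem_seq !tS.
set t1 := sem (PIf (RLe (cellR rTh) (cellR rZx)) _ _) t.
have [a1 [a2 [a3 [a4 a5]]]] : rmem t1 = rmem t /\ (forall a, a != vCx -> nmem t1 a = nmem t a) /\
   nmem t1 vCx u = (nmem t vCx u + (w *+ j <= rmem s rZx 0)%R)%N /\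
   (forall v, v != u -> nmem t1 vCx v = nmem t vCx v) /\ nmem t1 vCy = nmem t vCy.
  rewrite /t1 sem_if /= IH1 fr' //.
  case: (_ <= _); rewrite ?sem_n ?sem_skip /= ?(fr vU) // -/u; split=> //; split.
  - by move=> a /negPf h; rewrite /update h.
  - by rewrite eqxx addn1; split=> //; split=> // v /negPf ->.
  - by [].
  - by rewrite addn0.
set t2 := sem (PIf _ _ _) t1.
have [b1 [b3 [b4 b5]]] : rmem t2 = rmem t1 /\
   nmem t2 vCy u = (nmem t1 vCy u + (w *+ j <= rmem s rZy 0)%R)%N /\
   (forall v, v != u -> nmem t2 vCy v = nmem t1 vCy v) /\ nmem t2 vCx = nmem t1 vCx.
  rewrite /t2 sem_if /= a1 IH1 fr' //.
  case: (_ <= _); rewrite ?sem_n ?sem_skip /= ?(a2 vU) ?(fr vU) // -/u; split=> //.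
  - by rewrite eqxx addn1; split=> //; split=> // v /negPf ->.
  - by rewrite addn0.
rewrite sem_r /= b1 a1 IH1 !fr' // -/w b3 b5 a3 a5 IH2 IH3 !addnA mulrSr.
split=> //; split=> //; split=> // v vu; rewrite a4 // b4 // a5.
exact: IH4.
Qed.
End Loops.

Section Selection.
Variable R : realType.
Implicit Types s t : memory R.

Lemma cells_progP s u : (nmem s vM 0 <= nmem s 0 0)%N -> (u < nmem s 0 0)%N ->
  let p := nmem s vP 0 in let d := rmem s rDelta 0 in
  nmem (sem cells_prog s) vCx u =
    tcount (nmem s 0 0) (d + d) ((rmem s 0 u - rmem s 0 p + d) *+ nmem s vM 0) /\
  nmem (sem cells_prog s) vCy u =
    tcount (nmem s 0 0) (d + d) ((rmem s 1 u - rmem s 1 p + d) *+ nmem s vM 0).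
Proof.
move=> mn; move: u.
set n := nmem s 0 0 in mn *; set m := nmem s vM 0 in mn *.
apply: (sem_for (Inv := fun j t => forall u, (u < j)%N ->
  let p := nmem s vP 0 in let d := rmem s rDelta 0 in
  nmem t vCx u = tcount n (d + d) ((rmem s 0 u - rmem s 0 p + d) *+ m) /\
  nmem t vCy u = tcount n (d + d) ((rmem s 1 u - rmem s 1 p + d) *+ m))) => //.
move=> j t jn tj fr fr' IH u; rewrite ltnS leq_eqVlt => uj p d.
rewrite 5!sem_seq; set t1 := sem (PR _ _ _) _; rewrite sem_seq.
have nt1 : nmem t1 = update (update (nmem t) vCx j 0%N) vCy j 0%N.
  by rewrite /t1 !sem_r !sem_n /= tj.
have rt1 a y : a != rZx -> a != rZy -> a != rTh -> rmem t1 a y = rmem s a y.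
  move=> /negPf h4 /negPf h5 /negPf h6; rewrite /t1 !sem_r !sem_n /= h4 h5 h6 /= fr' //=.
  by rewrite !inE h4 h5 h6.
have r0 : rmem t1 rZx 0 = 0 /\ rmem t1 rZy 0 = 0 /\ rmem t1 rTh 0 = 0 by rewrite /t1 !sem_r !sem_n.
case: r0 => r4 [r5 r6]; clearbody t1.
have [] := @scale_progP _ t1; first by rewrite nt1 /= !fr.
rewrite r4 r5 !add0r nt1 /= tj !fr // !rt1 // -/m -/p -/d.
set t2 := sem scale_prog t1 => z4 z5.
have nt2 a y : a != vJ -> nmem t2 a y = nmem t1 a y.
  by move=> h; rewrite nframe //= !inE h.
have [] := @index_progP _ t2; first by rewrite rframe.
rewrite !nt2 // nt1 /= tj !eqxx /= z4 z5 (rframe (p := scale_prog) t1 (a := rDelta)) // rt1 // -/d fr // -/n.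
rewrite !add0n => h1 [h2 h3].
case/orP: uj => [/eqP->//|uj].
have uj' : u != j by rewrite neq_ltn uj.
have [-> ->] := h3 u uj'.
by rewrite !nt2 // nt1 /= (negPf uj'); apply: IH.
Qed.

Definition beforeb s (v u : nat) : bool :=
  (nmem s vCnt u < nmem s vCnt v)%N || (nmem s vCnt u == nmem s vCnt v) &&
  ((nmem s vCx v < nmem s vCx u)%N || (nmem s vCx v == nmem s vCx u) &&
  ((nmem s vCy v < nmem s vCy u)%N || (nmem s vCy v == nmem s vCy u) && (v < u)%N)).

Lemma teval_TAnd s b1 b2 : teval s (TAnd b1 b2) = teval s b1 && teval s b2.
Proof. by []. Qed.

Lemma teval_before s eu ev :
  teval s (before_test ev eu) = beforeb s (neval s ev) (neval s eu).
Proof. by rewrite /before_test !(teval_TOr, teval_TAnd, teval_NLt, teval_NEq). Qed.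

Definition selb s (u : nat) : bool :=
  inb s u && (\sum_(v < nmem s 0 0) (inb s v && beforeb s v u) < nmem s 0 1)%N.

Lemma select_progP s :
  nmem (sem select_prog s) vTot 0 = (\sum_(u < nmem s 0 0) selb s u)%N /\
  forall u, (u < nmem s 0 0)%N ->
    nmem (sem select_prog s) vSel u = selb s u /\ nmem (sem select_prog s) vAct u = selb s u.
Proof.
rewrite /select_prog sem_seq; set s1 := sem (setc vTot 0) s.
have -> : nmem s 0 0 = nmem s1 0 0 by [].
apply: (sem_for (Inv := fun j t => nmem t vTot 0 = (\sum_(u < j) selb s u)%N /\
  forall u, (u < j)%N -> nmem t vSel u = selb s u /\ nmem t vAct u = selb s u)) => //.
  by rewrite big_ord0.
move=> j t jn tj fr _ [IH1 IH2].
rewrite 2!sem_seq; set t1 := sem (setc vRank 0) t.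
have nt1 a y : a != vRank -> nmem t1 a y = nmem t a y.
  by move=> /negPf h; rewrite /t1 sem_n /= h.
have t1r : nmem t1 vRank 0 = 0%N by [].
clearbody t1.
have [] := @sem_count _ t1 vV (TAnd (NTrue vBall (cell0 vV)) (before_test (cell0 vV) (cell0 vU)))
   vRank (NConst 0) (fun v => inb s v && beforeb s v j) 0%N isT.
  move=> v t' vn tv fr'; split=> //.
  rewrite teval_TAnd teval_before /beforeb /inb /= tv !fr' // !nt1 // tj.
  by rewrite !fr.
rewrite (nt1 0%N) // (fr 0%N) // t1r add0n.
set t2 := sem (PFor vV _) t1 => h _.
have nt2 a y : a != vRank -> a != vV -> nmem t2 a y = nmem t a y.
  by move=> h1 h2; rewrite nframe //= ?nt1 // !inE negb_or h1 h2.
clearbody t2.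
rewrite sem_if /= addn1 h !nt2 // tj !fr //.
have sE : (0 < nmem s vBall j)%N && (\sum_(v < nmem s 0 0) (inb s v && beforeb s v j) < nmem s 0 1)%N
   = selb s j by [].
rewrite [nmem s1 _ _]/= sE big_ord_recr /= -IH1.
case E: (selb s j); rewrite !sem_seq !sem_n /= !nt2 //= tj.
  rewrite addn1; split=> // u; rewrite ltnS leq_eqVlt => /orP[/eqP->|uj]; first by rewrite eqxx E.
  have uj' : u != j by rewrite neq_ltn uj.
  by rewrite (negPf uj') !nt2 //; apply: IH2.
rewrite addn0; split=> // u; rewrite ltnS leq_eqVlt => /orP[/eqP->|uj]; first by rewrite eqxx E.
have uj' : u != j by rewrite neq_ltn uj.
by rewrite (negPf uj') !nt2 //; apply: IH2.
Qed.

End Selection.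

(** * The closest active pair *)

Section ClosestPair.
Variable R : realType.
Implicit Types s t : memory R.

Definition okpair s (a b : nat) : bool :=
  [&& (0 < nmem s vAct a)%N, (0 < nmem s vAct b)%N, (a < b)%N & (b < nmem s 0 0)%N].

(** [Q] describes the pairs scanned so far; the points are read in the memory [s] before the
    scan. *)
Definition closest s (Q : nat -> nat -> bool) t :=
  nmem t vFound 0 = 0%N /\ (forall a b, ~~ Q a b) \/
  nmem t vFound 0 = 1%N /\ Q (nmem t vBu 0) (nmem t vBv 0) /\
    rmem t rBest 0 = l1_dist (pt s (nmem t vBu 0)) (pt s (nmem t vBv 0)) /\
    forall a b, Q a b -> rmem t rBest 0 <= l1_dist (pt s a) (pt s b).

Lemma eq_closest s Q Q' t : Q =2 Q' -> closest s Q t -> closest s Q' t.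
Proof.
move=> QQ; case=> [[h1 h2]|[h1 [h2 [h3 h4]]]]; [left|right].
  by split=> // a b; rewrite -QQ.
by rewrite -QQ; split=> //; split=> //; split=> // a b; rewrite -QQ; apply: h4.
Qed.

Lemma closest_step s Q t j i :
    closest s Q t -> nmem t vU 0 = j -> nmem t vV 0 = i ->
    (forall a, nmem t vAct a = nmem s vAct a) -> (forall a, pt t a = pt s a) -> (i < nmem s 0 0)%N ->
  closest s (fun a b => Q a b || [&& okpair s a b, a == j & b == i])
    (sem (PIf (TAnd (NTrue vAct (cell0 vU)) (TAnd (NTrue vAct (cell0 vV)) (NLt (cell0 vU) (cell0 vV))))
      (PSeq (dist_prog (cell0 vU) (cell0 vV))
        (PIf (TOr (TNot (NTrue vFound (NConst 0))) (RLe (cellR rD) (cellR rBest)))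
          (PSeq (PR rBest (NConst 0) (cellR rD))
          (PSeq (PN vBu (NConst 0) (cell0 vU))
          (PSeq (PN vBv (NConst 0) (cell0 vV))
                (setc vFound 1))))
          PSkip))
      PSkip) t).
Proof.
move=> C tj ti act ptE it.
rewrite sem_if [teval _ _]/= tj ti !act addn1.
have okE : [&& (0 < nmem s vAct j)%N, (0 < nmem s vAct i)%N & (j < i)%N] = okpair s j i.
  by rewrite /okpair it andbT.
rewrite okE; case ok : (okpair s j i); last first.
  rewrite sem_skip; apply: eq_closest C => a b.
  have [-> /=|_] := eqVneq a j; last by rewrite andbF orbF.
  by have [->|_] := eqVneq b i; rewrite ?ok ?andbF orbF.
rewrite sem_seq; have [nt dt rt] := dist_progP t (cell0 vU) (cell0 vV).
rewrite /= tj ti !ptE in dt.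
move: nt dt rt; set t1 := sem (dist_prog _ _) t; clearbody t1 => nt dt rt.
rewrite sem_if teval_TOr /= dt rt // nt.
set t2 := sem (PSeq _ _) t1.
have new : nmem t2 vFound 0 = 1%N /\ nmem t2 vBu 0 = j /\ nmem t2 vBv 0 = i /\ 
    rmem t2 rBest 0 = l1_dist (pt s j) (pt s i).
  by rewrite /t2 !sem_seq !sem_n sem_r /= nt tj ti dt.
clearbody t2; case: new => n1 [n2 [n3 n4]].
have self : Q j i || [&& okpair s j i, j == j & i == i] by rewrite ok !eqxx orbT.
case: C => [[h1 h2]|[h1 [h2 [h3 h4]]]]; rewrite h1 /=.
  right; rewrite n1 n2 n3 n4; split=> //; split=> //; split=> // a b.
  by rewrite (negPf (h2 a b)) /= => /and3P[_ /eqP-> /eqP->].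
right; case: ifP => dle.
  rewrite n1 n2 n3 n4; split=> //; split=> //; split=> // a b.
  by case/orP=> [/h4|/and3P[_ /eqP-> /eqP->]] //; apply: le_trans.
rewrite sem_skip nt h1 h2; split=> //; split=> //; rewrite rt //; split=> // a b.
case/orP=> [/h4|/and3P[_ /eqP-> /eqP->]] //.
by move/negbT: dle; rewrite -ltNge => /ltW.
Qed.

Lemma pair_progP s : closest s (okpair s) (sem pair_prog s).
Proof.
rewrite /pair_prog sem_seq; set s1 := sem (setc vFound 0) s.
have n1 : nmem s1 0 0 = nmem s 0 0 by [].
have a1 a : nmem s1 vAct a = nmem s vAct a by [].
have p1 a : pt s1 a = pt s a by [].
have f1 : nmem s1 vFound 0 = 0%N by [].
clearbody s1.
(* This bound on [a] follows from [okpair]; it gives the goal the form of the outer invariant. *)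
apply: (@eq_closest _ (fun a b => okpair s a b && (a < nmem s1 0 0)%N)).
  move=> a b; rewrite n1 /okpair; apply: andb_idr => /and4P[_ _ ab bn].
  exact: ltn_trans bn.
apply: (sem_for (Inv := fun j t => closest s (fun a b => okpair s a b && (a < j)%N) t)) => //.
  by left; rewrite /= f1; split=> // a b; rewrite ltn0 andbF.
move=> j t jn tj fr fr' IH.
apply: (@eq_closest _ (fun a b => (okpair s a b && (a < j)%N) ||
   [&& okpair s a b, a == j & (b < nmem t 0 0)%N])).
  move=> a b; rewrite ltnS [(a <= j)%N]leq_eqVlt fr // n1.
  case ok : (okpair s a b) => //=; move: ok => /and4P[_ _ _ ->].
  by rewrite andbT orbC.
apply: (sem_for (Inv := fun i t' => closest s (fun a b => (okpair s a b && (a < j)%N) ||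
   [&& okpair s a b, a == j & (b < i)%N]) t')) => //.
  by apply: eq_closest IH => a b; rewrite ltn0 !andbF orbF.
move=> i t' in_ ti fr2 fr2' IH2.
have tj' : nmem t' vU 0 = j by rewrite fr2.
apply: eq_closest (closest_step IH2 tj' ti _ _ _) => [a b|a|a|].
- rewrite ltnS [(b <= i)%N]leq_eqVlt -orbA; congr (_ || _).
  by case: (okpair s a b); case: (a == j); case: (b == i); case: (b < i)%N.
- by rewrite fr2 // fr // a1.
- by rewrite -p1 /pt !fr2' // !fr'.
- by move: in_; rewrite fr // n1.
Qed.

End ClosestPair.

(** * The greedy tree *)

Definition edge_set (T : finType) (es : seq (T * T)) : {set {set T}} :=
  [set [set e.1; e.2] | e in es].

Lemma edge_set_rcons (T : finType) (es : seq (T * T)) u v :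
  edge_set (rcons es (u, v)) = [set u; v] |: edge_set es.
Proof.
apply/setP => x; rewrite in_setU1; apply/imsetP/orP.
  case=> e; rewrite mem_rcons inE => /orP[/eqP->|ee] ->; first by left.
  by right; apply: imset_f.
case=> [/eqP->|/imsetP[e ee ->]]; first by exists (u, v); rewrite // mem_rcons mem_head.
by exists e; rewrite // mem_rcons inE ee orbT.
Qed.

Lemma edge_set_nil (T : finType) : edge_set [::] = set0 :> {set {set T}}.
Proof. by apply/setP => x; rewrite inE; apply/imsetP => -[]. Qed.

Section Span.
Variables (R : realType) (n : nat) (P : 'I_n -> R * R) (Sel : {set 'I_n}).
Implicit Types (s t : memory R) (es : seq ('I_n * 'I_n)) (A : {set 'I_n}).

Definition stored_edges t es :=
  [seq (val e.1, val e.2) | e <- es] = mkseq (fun i => (nmem t vA i, nmem t vB i)) (nmem t vNe 0).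

(* The tree is grown backwards: [A] is the set of the points still active, and
   the stored edges complete any tree on [A]. *)
Definition span_inv (j : nat) t := exists A es,
  [/\ [/\ forall u : 'I_n, (0 < nmem t vAct u)%N = (u \in A), A \subset Sel, A != set0 &
          (#|A| <= 1)%N \/ (#|A| + j <= #|Sel|)%N],
      [/\ stored_edges t es, uniq (map fst es), (forall e, e \in es -> e.1 \notin A) &
          (size es + #|A| = #|Sel|)%N],
      (forall E0, is_tree A E0 -> is_tree Sel (edge_set es :|: E0) /\
         rect_length P (edge_set es :|: E0) = rmem t rLen 0 + rect_length P E0) &
      forall f : nat -> R,
        (forall B : {set 'I_n}, B \subset Sel -> (1 < #|B|)%N ->
           exists u v, [/\ u \in B, v \in B, u != v & l1_dist (P u) (P v) <= f #|B|]) ->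
        rmem t rLen 0 <= \sum_(#|A| <= i < #|Sel|) f i.+1].

(** The pair found joins the discarded [u] to [v], still active. In a tree on [A] minus [u], this
    edge adds the leaf [u], and the invariant completes the resulting tree on [A]. If no pair is
    found, at most one active point is left. *)
Lemma span_step j t :
    nmem t 0 0 = n -> (forall u : 'I_n, pt t u = P u) -> span_inv j t ->
  span_inv j.+1 (sem (PSeq pair_prog
      (PIf (NTrue vFound (NConst 0))
        (PSeq (PN vA (cell0 vNe) (cell0 vBu))
        (PSeq (PN vB (cell0 vNe) (cell0 vBv))
        (PSeq (inc vNe (NConst 0))
        (PSeq (PR rLen (NConst 0) (RAdd (cellR rLen) (cellR rBest)))
              (PN vAct (cell0 vBu) (NConst 0))))))
        PSkip)) t).
Proof.
move=> tn tP [A [es [[actA AS A0 cardA] [st uq fA sz] tree len]]].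
rewrite sem_seq; have C := pair_progP t.
have fr a y : a \notin nwrites pair_prog -> nmem (sem pair_prog t) a y = nmem t a y by apply: nframe.
have fr' a y : a \notin rwrites pair_prog -> rmem (sem pair_prog t) a y = rmem t a y by apply: rframe.
move: fr fr' C; set t1 := sem pair_prog t; clearbody t1 => fr fr' C.
have ok (u v : 'I_n) : u \in A -> v \in A -> (u < v)%N -> okpair t u v.
  by move=> uA vA uv; rewrite /okpair !actA uA vA uv tn ltn_ord.
case: C => [[h1 h2]|[h1 [h2 [h3 h4]]]]; rewrite sem_if /= h1 /=.
  rewrite sem_skip; exists A, es; split.
  - split=> //; first by move=> u; rewrite fr.
    left; rewrite leqNgt; apply/negP => /card_gt1P[u [v [uA vA]]].
    rewrite neq_ltn => /orP[uv|vu].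
      by have := h2 u v; rewrite ok.
    by have := h2 v u; rewrite ok.
  - by split=> //; rewrite /stored_edges !fr // st; apply: eq_mkseq => i; rewrite !fr.
  - by move=> E0 /tree[? ->]; rewrite fr'.
  - by rewrite fr'.
move: h2; rewrite /okpair tn => /and4P[a1 a2 ab bn].
have an := ltn_trans ab bn.
pose u := Ordinal an; pose v := Ordinal bn.
have uA : u \in A by rewrite -actA.
have vA : v \in A by rewrite -actA.
have uv : u != v by rewrite neq_ltn ab.
have vAu : v \in A :\ u by rewrite !inE eq_sym uv.
have cA : #|A| = #|A :\ u|.+1 by rewrite (cardsD1 u A) uA.
have ule (x y : 'I_n) : x \in A -> y \in A -> x != y -> rmem t1 rBest 0 <= l1_dist (P x) (P y).
  move=> xA yA; rewrite neq_ltn => /orP[xy|yx].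
    by have := h4 x y; rewrite ok // !tP; apply.
  by rewrite l1_distC; have := h4 y x; rewrite ok // !tP; apply.
have best : rmem t1 rBest 0 = l1_dist (P u) (P v) by rewrite h3 -!tP.
have ne : nmem t1 vNe 0 = size es.
  by rewrite fr //; have := congr1 size st; rewrite size_map size_mkseq.
rewrite !sem_seq !sem_n sem_r /=.
exists (A :\ u), (rcons es (u, v)); split.
- split.
  + move=> x /=; rewrite !inE -val_eqE /=; case: eqP => //= _.
    by rewrite fr // actA.
  + by apply: subset_trans AS; apply: subsetDl.
  + by apply/set0Pn; exists v.
  + right; case: cardA; rewrite cA; last by lia.
    by rewrite ltnS leqn0 cards_eq0 => /eqP h; move: vAu; rewrite h inE.
- split.
  + rewrite /stored_edges /= map_rcons /= addn1 mkseqS /= !eqxx /=.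
    congr (rcons _ _); rewrite [LHS]st -(fr vNe) //.
    rewrite /mkseq; apply/eq_in_map => i; rewrite mem_iota add0n => /= /ltn_eqF ->.
    by rewrite !fr.
  (* First endpoints are the discarded points, hence distinct; this is what excludes repeated edges
     in the output. *)
  + rewrite map_rcons rcons_uniq uq andbT; apply/mapP => -[e ee eu].
    by have := fA _ ee; rewrite -eu uA.
  + move=> e; rewrite mem_rcons inE => /orP[/eqP->|/fA h]; first by rewrite !inE eqxx.
    by rewrite inE negb_and h orbT.
  + by rewrite size_rcons -sz cA addSnnS.
- move=> E0 tE0.
  have uE0 : [set u; v] \notin E0.
    case: tE0 => _ gE0 _ _; apply/negP => /gE0[/subsetP/(_ u) h _].
    by move: h; rewrite !inE eqxx /= => /(_ isT).
  have tE1 : is_tree A ([set u; v] |: E0).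
    by rewrite -(setD1K uA); apply: tree_leaf => //; rewrite !inE eqxx.
  have [T1 L1] := tree _ tE1.
  have e : edge_set (rcons es (u, v)) :|: E0 = edge_set es :|: ([set u; v] |: E0).
    by rewrite edge_set_rcons setUCA setUA.
  by rewrite e L1 rect_length_leaf // fr' // best addrA.
- move=> f Hf /=.
  (* The joined pair is closest in [A], so it costs at most the new term [f #|A|]. *)
  rewrite big_ltn; last by rewrite -cA subset_leq_card.
  rewrite -cA addrC lerD //; last by rewrite fr' //; apply: len.
  have A1 : (1 < #|A|)%N by rewrite cA ltnS card_gt0; apply/set0Pn; exists v.
  have [x [y [xA yA xy]]] := Hf A AS A1.
  by apply: le_trans; apply: ule.
Qed.
End Span.

Lemma rect_length0 (R : realType) (n : nat) (P : 'I_n -> R * R) : rect_length P set0 = 0.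
Proof.
rewrite /rect_length big1 // => u _; rewrite big1 // => v.
by rewrite /adjacent inE andbF.
Qed.

Lemma span_progP (R : realType) (n : nat) (P : 'I_n -> R * R) (Sel : {set 'I_n}) (s : memory R) :
    nmem s 0 0 = n -> (forall u : 'I_n, pt s u = P u) -> Sel != set0 ->
    (forall u : 'I_n, (0 < nmem s vAct u)%N = (u \in Sel)) ->
  exists es, [/\ stored_edges (sem span_prog s) es, uniq es, (size es <= n)%N,
    is_tree Sel (edge_set es) /\ rect_length P (edge_set es) = rmem (sem span_prog s) rLen 0 &
    forall f : nat -> R,
      (forall B : {set 'I_n}, B \subset Sel -> (1 < #|B|)%N ->
         exists u v, [/\ u \in B, v \in B, u != v & l1_dist (P u) (P v) <= f #|B|]) ->
      rmem (sem span_prog s) rLen 0 <= \sum_(1 <= i < #|Sel|) f i.+1].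
Proof.
move=> sn sP Sel0 actS.
have : span_inv P Sel n (sem span_prog s).
  rewrite -[X in span_inv _ _ X _]sn /span_prog 2!sem_seq; set s1 := sem _ (sem _ s).
  have n1 : nmem s1 = update (nmem s) vNe 0 0%N by [].
  have r1 : rmem s1 = update (rmem s) rLen 0 0 by [].
  clearbody s1.
  have -> : nmem s 0 0 = nmem s1 0 0 by rewrite n1.
  apply: (sem_for (Inv := span_inv P Sel)) => //.
    exists Sel, [::]; split.
    - by split=> //; [move=> u; rewrite /= n1 /= actS|right; rewrite addn0].
    - by split=> //; rewrite /stored_edges /= n1.
    - by move=> E0 tE0; rewrite edge_set_nil set0U /= r1 /= add0r.
    - by move=> f _; rewrite /= r1 /= big_geq.
  move=> j t jn tj fr fr' IH.
  have tn : nmem t 0 0 = n by rewrite fr // n1.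
  have tP u : pt t (nat_of_ord u) = P u by rewrite -sP /pt !fr' // r1.
  have [A [es [h1 h2 h3 h4]]] := span_step tn tP IH.
  by exists A, es; split.
case=> [A [es [[actA AS A0 cardA] [st uq fA sz] tree len]]].
(* Otherwise [n] rounds would have discarded [n] of the at most [n] selected points, leaving
   none. *)
have A1 : #|A| = 1%N.
  apply/eqP; rewrite eqn_leq card_gt0 A0 andbT.
  case: cardA => // h; have : (#|Sel| <= n)%N by rewrite -[leqRHS]card_ord max_card.
  by move: A0; rewrite -card_gt0; lia.
exists es; split=> //.
- exact: map_uniq uq.
- have : (#|Sel| <= n)%N by rewrite -[leqRHS]card_ord max_card.
  by lia.
(* The empty set of edges is a tree on the last active point, and the stored edges complete it. *)
- case/cards1P: (introT eqP A1) => u Au.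
  by have := tree set0; rewrite Au setU0 rect_length0 addr0 => /(_ (tree_singleton u)) [? ->].
- by move=> f Hf; have := len f Hf; rewrite A1.
Qed.

(** * Recording the best tree *)

Section Record.
Variables (R : realType) (n : nat).
Implicit Types s t : memory R.

Lemma vertices_progP s : nmem s 0 0 = n ->
  [seq val v | v <- [seq u <- enum 'I_n | (0 < nmem s vSel (val u))%N]] =
    mkseq (nmem (sem vertices_prog s) 2) (nmem (sem vertices_prog s) 1 0).
Proof.
move=> sn.
rewrite -(filter_map val (fun u => (0 < nmem s vSel u)%N)) val_enum_ord -sn.
rewrite /vertices_prog sem_seq; set s1 := sem (PN _ _ _) s.
have n1 : nmem s1 = update (nmem s) 1 0 0%N by [].
clearbody s1.
have -> : nmem s 0 0 = nmem s1 0 0 by rewrite n1.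
apply: (sem_for (Inv := fun j t => [seq u <- iota 0 j | (0 < nmem s vSel u)%N] =
   mkseq (nmem t 2) (nmem t 1 0))) => //; first by rewrite /= n1.
move=> j t jn tj fr _ IH.
rewrite -[j.+1]addn1 iotaD cats1 filter_rcons add0n IH.
rewrite sem_if /= tj (fr vSel) // n1 /=.
case: ifP => _; last by rewrite sem_skip.
rewrite sem_seq !sem_n /= tj !addn1 mkseqS /= eqxx; congr (rcons _ _).
rewrite /mkseq; apply/eq_in_map => i; rewrite mem_iota add0n => /= /ltn_eqF ->.
by [].
Qed.

Lemma edges_progP s : nmem (sem edges_prog s) 1 1 = nmem s vNe 0 /\
  nmem (sem edges_prog s) 1 0 = nmem s 1 0 /\
  forall i, (i < nmem s 0 0)%N -> nmem (sem edges_prog s) 3 i = nmem s vA i /\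
     nmem (sem edges_prog s) 4 i = nmem s vB i.
Proof.
rewrite /edges_prog sem_seq; set s1 := sem (PN _ _ _) s.
have n1 : nmem s1 = update (nmem s) 1 1 (nmem s vNe 0) by [].
clearbody s1.
rewrite !(nframe _ (a := 1%N)) // n1; split=> //; split=> //.
have -> : nmem s 0 0 = nmem s1 0 0 by rewrite n1.
apply: (sem_for (Inv := fun j t => forall i, (i < j)%N -> nmem t 3 i = nmem s vA i /\
     nmem t 4 i = nmem s vB i)) => //.
move=> j t jn tj fr _ IH i; rewrite ltnS leq_eqVlt sem_seq !sem_n /= tj.
case/orP=> [/eqP->|ij]; first by rewrite eqxx !fr // n1.
have ij' : i != j by rewrite neq_ltn ij.
by rewrite (negPf ij'); apply: IH.
Qed.

Lemma output_graph_eq s t (S : {set 'I_n}) E :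
    (forall a y, (0 < a < 5)%N -> nmem t a y = nmem s a y) ->
  output_graph s S E -> output_graph t S E.
Proof.
move=> H [vs [es [uq hv he hS hE]]]; exists vs, es; split=> //.
  by rewrite hv H // /mkseq; apply: eq_map => i; rewrite H.
by rewrite he H // /mkseq; apply: eq_map => i; rewrite !H.
Qed.

Lemma record_graph s (Sel : {set 'I_n}) es :
    nmem s 0 0 = n -> (forall u : 'I_n, (0 < nmem s vSel u)%N = (u \in Sel)) ->
    uniq es -> (size es <= n)%N -> stored_edges s es ->
  output_graph (sem (PSeq vertices_prog edges_prog) s) Sel (edge_set es).
Proof.
move=> sn selS ues szes st.
have V := vertices_progP sn.
rewrite sem_seq; have [e1 [e2 e3]] := edges_progP (sem vertices_prog s).
have e4 y : nmem (sem edges_prog (sem vertices_prog s)) 2 y = nmem (sem vertices_prog s) 2 y.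
  exact: nframe.
move: e1 e2 e3 e4; rewrite (nframe _ (a := vNe)) // (nframe _ (a := 0%N)) // sn => e1 e2 e3 e4.
exists [seq u <- enum 'I_n | (0 < nmem s vSel (val u))%N], es; split=> //.
- by rewrite filter_uniq // enum_uniq.
- rewrite V e2 /mkseq; apply: eq_map => i; by rewrite e4.
- rewrite st e1 /mkseq.
  have -> : nmem s vNe 0 = size es by have := congr1 size st; rewrite size_map size_mkseq.
  apply/eq_in_map => i; rewrite mem_iota add0n => /= ilt.
  have [-> ->] := e3 i (leq_trans ilt szes).
  by rewrite !nframe.
- by apply/setP => u; rewrite inE mem_filter mem_enum andbT selS.
Qed.

Lemma record_progP s (Sel : {set 'I_n}) es :
    nmem s 0 0 = n -> (forall u : 'I_n, (0 < nmem s vSel u)%N = (u \in Sel)) ->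
    uniq es -> (size es <= n)%N -> stored_edges s es ->
    (nmem s 0 1 <= nmem s vTot 0)%N && ((nmem s vHave 0 == 0) || (rmem s rLen 0 <= rmem s rBestLen 0)) ->
  [/\ output_graph (sem record_prog s) Sel (edge_set es),
      nmem (sem record_prog s) vHave 0 = 1%N & rmem (sem record_prog s) rBestLen 0 = rmem s rLen 0].
Proof.
move=> sn selS ues szes st c.
rewrite /record_prog sem_if [teval _ _]/= negb_and !negbK -leqNgt leqn0 c.
rewrite 2!sem_seq; set s1 := sem _ (sem _ s).
have n1 : nmem s1 = update (nmem s) vHave 0 1%N by [].
have r1 : rmem s1 = update (rmem s) rBestLen 0 (rmem s rLen 0) by [].
clearbody s1; split.
- apply: record_graph => //; rewrite ?n1 //.
  by rewrite /stored_edges n1.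
- by rewrite nframe // n1.
- by rewrite rframe // r1.
Qed.

Lemma record_prog_skip s :
    ~~ ((nmem s 0 1 <= nmem s vTot 0)%N && ((nmem s vHave 0 == 0) || (rmem s rLen 0 <= rmem s rBestLen 0))) ->
  sem record_prog s = s.
Proof.
by move=> c; rewrite /record_prog sem_if [teval _ _]/= negb_and !negbK -leqNgt leqn0 (negPf c).
Qed.

End Record.

(** The last increment was made while [(m - 1) ^ 2 < k], whence both [m <= n] and
    [m ^ 2 <= 4 * k]. *)
Lemma grid_size_progP (R : realType) (s : memory R) : (0 < nmem s 0 1 <= nmem s 0 0)%N ->
  let m := nmem (sem grid_size_prog s) vM 0 in
  [/\ (0 < m)%N, (m <= nmem s 0 0)%N, (nmem s 0 1 <= m ^ 2)%N & (m ^ 2 <= 4 * nmem s 0 1)%N].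
Proof.
case/andP=> k0 kn m.
have : nmem (sem grid_size_prog s) vSq 0 = (m ^ 2)%N /\
  (m = 0 \/ m.-1 ^ 2 < nmem s 0 1)%N /\ (nmem s 0 1 <= m ^ 2 \/ m = nmem s 0 0)%N.
  rewrite /m /grid_size_prog 2!sem_seq; set s1 := sem _ (sem _ s).
  have n1 : nmem s1 = update (update (nmem s) vM 0 0%N) vSq 0 0%N by [].
  clearbody s1.
  have -> : nmem s 0 0 = nmem s1 0 0 by rewrite n1.
  (* Until [k] is reached every round increments [m], so [m = j]; at the end [m = n] gives
     [k <= n <= m ^ 2]. *)
  apply: (sem_for (Inv := fun j t => nmem t vSq 0 = (nmem t vM 0 ^ 2)%N /\
    (nmem t vM 0 = 0 \/ (nmem t vM 0).-1 ^ 2 < nmem s 0 1)%N /\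
    (nmem s 0 1 <= nmem t vM 0 ^ 2 \/ nmem t vM 0 = j)%N)) => //.
    by rewrite /= n1 /=; split=> //; split; [left|right].
  move=> j t jn tj fr _ [IH1 [IH2 IH3]].
  rewrite sem_if teval_NLt /= (fr 0%N) // n1 /= IH1; case: ltnP => h.
    rewrite sem_seq !sem_n /= IH1; move: IH2 IH3 h; move: (nmem t vM 0) => x IH2 IH3 h.
    split; first by nia.
    by split; right; rewrite addn1 //=; lia.
  by rewrite sem_skip; split=> //; split=> //; left.
case=> _ []; clearbody m; move: (nmem s 0 1) (nmem s 0 0) k0 kn => k n k0 kn h1 h2.
have km : (k <= m ^ 2)%N by case: h2 => // ->; nia.
have m0 : (0 < m)%N by move: km; case: (m); lia.
have h : (m.-1 ^ 2 < k)%N by case: h1 => // m00; rewrite m00 in m0.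
split=> //; first by nia.
by nia.
Qed.

Section Before.
Variables (R : realType) (s : memory R).

Lemma beforeb_irr : irreflexive (beforeb s).
Proof. by move=> u; rewrite /beforeb !ltnn !eqxx. Qed.

Lemma beforeb_trans : transitive (beforeb s).
Proof. by move=> v u w; rewrite /beforeb; lia. Qed.

Lemma beforeb_total u v : u != v -> beforeb s u v || beforeb s v u.
Proof. by rewrite /beforeb; lia. Qed.

End Before.

Lemma sum_ord_card (n : nat) (f : nat -> bool) :
  (\sum_(v < n) f v)%N = #|[set v : 'I_n | f v]|.
Proof. by rewrite -sum1dep_card [RHS]big_mkcond /=; apply: eq_bigr => v _; case: (f v). Qed.

(** * The guarantee for one pair of centers *)

Section Iteration.
Variables (R : realType) (n k m : nat) (P : 'I_n -> R * R).
Hypotheses (k0 : (0 < k)%N) (m0 : (0 < m)%N) (mn : (m <= n)%N).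
Hypotheses (km : (k <= m ^ 2)%N) (mk : (m ^ 2 <= 4 * k)%N).
Implicit Types s t : memory R.

Definition centers_ball (p q : 'I_n) := ball P p (l1_dist (P p) (P q)).

(** [Q] holds of the pairs of centers already treated. The guarantee covers every [k]-point tree in
    the ball that contains both centers, since the pair fitting an optimal tree is unknown. *)
Definition best_inv (Q : rel 'I_n) t :=
  (nmem t vHave 0 = 0%N \/ exists S E, [/\ output_graph t S E, is_tree S E, (k <= #|S|)%N &
     rect_length P E = rmem t rBestLen 0]) /\
  forall p q, Q p q -> (k <= #|centers_ball p q|)%N -> nmem t vHave 0 != 0%N /\
    forall S E, is_tree S E -> #|S| = k -> p \in S -> q \in S -> S \subset centers_ball p q ->
      rmem t rBestLen 0 <= 96 * k%:R `^ (4%:R^-1) * rect_length P E.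

(** Hides the memory behind an abstract order that satisfies the hypotheses of [select_cells]. *)
Lemma select_phase t (p q : 'I_n) :
    nmem t 0 0 = n -> nmem t 0 1 = k -> nmem t vM 0 = m -> (forall u : 'I_n, pt t u = P u) ->
    nmem t vP 0 = p -> nmem t vQ 0 = q ->
  let B := centers_ball p q in let cell := cell P p (l1_dist (P p) (P q)) m in
  let s := sem select_prog (sem counts_prog (sem cells_prog (sem ball_prog t))) in
  exists2 lt : rel 'I_n,
    [/\ irreflexive lt, transitive lt, (forall u v, u != v -> lt u v || lt v u),
     (forall u v, #|[set x in B | cell x == cell u]| < #|[set x in B | cell x == cell v]| -> lt v u)%N &
     (forall u v w, cell u = cell v -> cell w != cell u -> lt u w -> lt v w)] &
    let Sel := [set u in B | #|[set v in B | lt v u]| < k]%N in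
    [/\ forall u : 'I_n, nmem s vSel u = (u \in Sel), forall u : 'I_n, nmem s vAct u = (u \in Sel) &
       nmem s vTot 0 = #|Sel|].
Proof.
clear k0 m0 km mk; move=> tn tk tm tP tp tq B cell.
have tP1 (u : 'I_n) : rmem t 0 u = (P u).1 by rewrite -tP.
have tP2 (u : 'I_n) : rmem t 1 u = (P u).2 by rewrite -tP.
have [d1 b1] := ball_progP t; rewrite tp tq !tP tn in d1 b1.
have fr1 a y : a \notin nwrites ball_prog -> nmem (sem ball_prog t) a y = nmem t a y by apply: nframe.
have fr1' a y : a \notin rwrites ball_prog -> rmem (sem ball_prog t) a y = rmem t a y by apply: rframe.
move: d1 b1 fr1 fr1'; set s1 := sem ball_prog t; clearbody s1 => d1 b1 fr1 fr1'.
have c2 := @cells_progP _ s1.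
have fr2 a y : a \notin nwrites cells_prog -> nmem (sem cells_prog s1) a y = nmem s1 a y by apply: nframe.
move: c2 fr2; set s2 := sem cells_prog s1; clearbody s2 => c2 fr2.
have {}c2 (u : 'I_n) : nmem s2 vCx u = cellx P p (l1_dist (P p) (P q)) m u /\
     nmem s2 vCy u = celly P p (l1_dist (P p) (P q)) m u.
  have h1 : (nmem s1 vM 0 <= nmem s1 0 0)%N by rewrite !fr1 // tm tn.
  have h2 : (u < nmem s1 0 0)%N by rewrite fr1 // tn.
  by have [-> ->] := c2 _ h1 h2; rewrite !fr1 // tm tn tp d1 !fr1' // !tP1 !tP2.
have c3 := @counts_progP _ s2.
have fr3 a y : a \notin nwrites counts_prog -> nmem (sem counts_prog s2) a y = nmem s2 a y by apply: nframe.
move: c3 fr3; set s3 := sem counts_prog s2; clearbody s3 => c3 fr3.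
have s2n : nmem s2 0 0 = n by rewrite fr2 // fr1.
have inbE (x : 'I_n) : inb s2 x = (x \in B).
  by rewrite /inb fr2 // b1 // tP lt0b inE.
have cellE (u v : 'I_n) : (cell u == cell v) =
    (nmem s2 vCx u == nmem s2 vCx v) && (nmem s2 vCy u == nmem s2 vCy v).
  by have [-> ->] := c2 u; have [-> ->] := c2 v; apply: cell_eq.
have {}c3 (u : 'I_n) : nmem s3 vCnt u = #|[set x in B | cell x == cell u]|.
  rewrite c3 s2n // (@sum_ord_card n (fun v => inb s2 v && same s2 v u)); apply: eq_card => v.
  by rewrite in_set [RHS]in_set -inbE cellE.
have [s4t s4s] := select_progP s3.
have s3n : nmem s3 0 0 = n by rewrite fr3.
have s3k : nmem s3 0 1 = k by rewrite fr3 // fr2 // fr1.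
exists (fun u v : 'I_n => beforeb s3 u v).
  split.
  - by move=> u; apply: beforeb_irr.
  - by move=> v u w; apply: beforeb_trans.
  - by move=> u v; apply: beforeb_total.
  - by move=> u v; rewrite -!c3 /beforeb => ->.
  - move=> u v w cuv; rewrite cellE.
    have c15 : nmem s3 vCnt u = nmem s3 vCnt v by rewrite !c3 cuv.
    have /eqP := cuv; rewrite cellE /beforeb c15 !(fr3 vCx) // !(fr3 vCy) //.
    lia.
move=> Sel.
have selE (u : 'I_n) : selb s3 u = (u \in Sel).
  rewrite /selb inE s3n s3k (@sum_ord_card n (fun v => inb s3 v && beforeb s3 v u)).
  have inb3 (v : 'I_n) : inb s3 v = (v \in B) by rewrite -inbE /inb fr3.
  rewrite inb3; congr (_ && (_ < _)%N); apply: eq_card => v.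
  by rewrite in_set [RHS]in_set inb3.
split.
- by move=> u; have [|-> _] := s4s u; rewrite ?s3n // selE.
- by move=> u; have [|_ ->] := s4s u; rewrite ?s3n // selE.
- by rewrite s4t s3n (@sum_ord_card n (selb s3)); apply: eq_card => u; rewrite inE selE.
Qed.

Lemma selection_budget (p q : 'I_n) (lt : rel 'I_n) (len : R) :
  let d := l1_dist (P p) (P q) in let B := centers_ball p q in let cell := cell P p d m in
  let Sel := [set u in B | #|[set v in B | lt v u]| < k]%N in
    irreflexive lt -> transitive lt -> (forall u v, u != v -> lt u v || lt v u) ->
    (forall u v, #|[set x in B | cell x == cell u]| < #|[set x in B | cell x == cell v]| -> lt v u)%N ->
    (forall u v w, cell u = cell v -> cell w != cell u -> lt u w -> lt v w) ->
    (k <= #|B|)%N ->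
    (forall f : nat -> R,
      (forall A : {set 'I_n}, A \subset Sel -> (1 < #|A|)%N ->
         exists u v, [/\ u \in A, v \in A, u != v & l1_dist (P u) (P v) <= f #|A|]) ->
      len <= \sum_(1 <= i < k) f i.+1) ->
  forall S E, is_tree S E -> #|S| = k -> p \in S -> q \in S -> S \subset B ->
      len <= 96 * k%:R `^ (4%:R^-1) * rect_length P E.
Proof.
move=> d B cell Sel irr tr tot ltN ltC kB lenH S E [_ _ cSE _] Sk pS qS SB.
have d0 : 0 <= d by apply: l1_dist_ge0.
have dL : d <= rect_length P E by apply: dist_le_rect_length cSE _ _.
have SelB : Sel \subset B by apply/subsetP => u; rewrite inE => /andP[].
pose g := #|cell @: Sel|.
(* The selection meets no more cells than the unknown tree, so the lower bound for the cells of [S]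
   applies to [g]. *)
have gle : (g <= #|cell @: S|)%N by apply: select_cells => //; rewrite Sk.
have gd : g%:R * d <= 4 * m%:R * rect_length P E.
  apply: le_trans (cells_tree d0 m0 mn cSE pS SB dL).
  by rewrite ler_wpM2r // ler_nat.
have r0 : 0 <= k%:R `^ (4%:R^-1) :> R by apply: powR_ge0.
have r4 : (k%:R `^ (4%:R^-1)) ^+ 4 = k%:R :> R.
  by rewrite -powR_mulrn // -powRrM mulVf ?pnatr_eq0 // powRr1.
have := grid_budget_le d0 m0 km mk r0 r4 (rect_length_ge0 P E) dL gd.
apply: le_trans.
have := lenH (fun i => grid_budget d m g i - grid_budget d m g i.-1).
have close (A : {set 'I_n}) : A \subset Sel -> (1 < #|A|)%N ->
    exists u v, [/\ u \in A, v \in A, u != v &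
      l1_dist (P u) (P v) <= grid_budget d m g #|A| - grid_budget d m g #|A|.-1].
  move=> AS A1; have cA : #|A| = #|A|.-1.+1 by lia.
  rewrite {1}cA; apply: (close_pair_budget (p := p)) => //.
  - exact: subset_trans AS SelB.
  - lia.
  - by apply: subset_leq_card; apply: imsetS.
(* The sum is the budget at [k] minus the budget at 1, which is nonnegative. *)
move=> /(_ close) /le_trans; apply; rewrite telescope_sumr // lerBlDr lerDl.
by rewrite addr_ge0 // !mulr_ge0 ?invr_ge0 // ?mulr_ge0 ?sqrtr_ge0.
Qed.

End Iteration.

(** * Scanning all pairs of centers *)

Section Main.
Variables (R : realType) (n k m : nat) (P : 'I_n -> R * R).
Hypotheses (k0 : (0 < k)%N) (m0 : (0 < m)%N) (mn : (m <= n)%N).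
Hypotheses (km : (k <= m ^ 2)%N) (mk : (m ^ 2 <= 4 * k)%N).
Implicit Types s t : memory R.

(** The invariant reads only the output arrays 1 to 4, the flag and the best length. *)
Lemma best_inv_eq Q s t :
    (forall a y, (0 < a < 5)%N -> nmem t a y = nmem s a y) -> nmem t vHave 0 = nmem s vHave 0 ->
    rmem t rBestLen 0 = rmem s rBestLen 0 ->
  best_inv k P Q s -> best_inv k P Q t.
Proof.
move=> Hn h26 h9 [h1 h2]; rewrite /best_inv h26 h9; split=> //.
case: h1 => [->|[S [E [oG tS kS len]]]]; first by left.
by right; exists S, E; split=> //; apply: output_graph_eq oG.
Qed.

Lemma eq_best_inv (Q Q' : rel 'I_n) t : Q =2 Q' -> best_inv k P Q t -> best_inv k P Q' t.
Proof. by move=> QQ [h1 h2]; split=> // p q; rewrite -QQ; apply: h2. Qed.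

(** Once a tree is recorded the best length never increases, so earlier guarantees persist. The new
    pair is served by the new tree or, if that one is not recorded, by a shorter one already
    there. *)
Lemma best_inv_step Q t (p q : 'I_n) :
    nmem t 0 0 = n -> nmem t 0 1 = k -> nmem t vM 0 = m -> (forall u : 'I_n, pt t u = P u) ->
    nmem t vP 0 = p -> nmem t vQ 0 = q -> best_inv k P Q t ->
  best_inv k P (fun p' q' => Q p' q' || (p' == p) && (q' == q)) (sem pair_of_centers_prog t).
Proof.
move=> tn tk tm tP tp tq Hinv.
have [lt [irr tr tot ltN ltC]] := select_phase mn tn tk tm tP tp tq.
rewrite /pair_of_centers_prog 5!sem_seq.
set s := sem select_prog _.
have fs a y : [&& a \notin nwrites ball_prog, a \notin nwrites cells_prog, a \notin nwrites counts_prog &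
       a \notin nwrites select_prog] ->
    nmem s a y = nmem t a y.
  by case/and4P=> *; rewrite /s !nframe //.
have fs' a y : [&& a \notin rwrites ball_prog, a \notin rwrites cells_prog, a \notin rwrites counts_prog &
       a \notin rwrites select_prog] ->
    rmem s a y = rmem t a y.
  by case/and4P=> *; rewrite /s !rframe //.
set B := centers_ball P p q in ltN ltC *.
set Sel := [set u in B | _]; clearbody s => -[selE actE totE].
have fu a y : a \notin nwrites span_prog -> nmem (sem span_prog s) a y = nmem s a y by apply: nframe.
have fu' a y : a \notin rwrites span_prog -> rmem (sem span_prog s) a y = rmem s a y by apply: rframe.
have cardSel : #|Sel| = minn k #|B| by apply: card_select.
have spanP : (k <= #|B|)%N -> exists es, [/\ stored_edges (sem span_prog s) es, uniq es, (size es <= n)%N,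
    is_tree Sel (edge_set es) /\ rect_length P (edge_set es) = rmem (sem span_prog s) rLen 0 &
    forall S E, is_tree S E -> #|S| = k -> p \in S -> q \in S -> S \subset B ->
      rmem (sem span_prog s) rLen 0 <= 96 * k%:R `^ (4%:R^-1) * rect_length P E].
  move=> kB.
  have [||||es [h1 h2 h3 h4 h5]] := @span_progP R n P Sel s.
  - by rewrite fs.
  - by move=> u; rewrite -tP /pt !fs'.
  - by rewrite -card_gt0 cardSel; lia.
  - by move=> u; rewrite actE lt0b.
  exists es; split=> //; apply: (@selection_budget R n k m P _ _ _ _ _ p q lt) => //.
  have ck : #|Sel| = k by rewrite cardSel; lia.
  by move=> f /h5; rewrite ck.
have {}Hinv : best_inv k P Q (sem span_prog s).
  apply: best_inv_eq Hinv.
  - by move=> a y; case: a => [|[|[|[|[|a]]]]] // _; rewrite fu // fs.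
  - by rewrite fu // fs.
  - by rewrite fu' // fs'.
have un : nmem (sem span_prog s) 0 0 = n by rewrite fu // fs.
have uk : nmem (sem span_prog s) 0 1 = k by rewrite fu // fs.
have uS (u : 'I_n) : (0 < nmem (sem span_prog s) vSel u)%N = (u \in Sel) by rewrite fu // selE lt0b.
have ut : nmem (sem span_prog s) vTot 0 = #|Sel| by rewrite fu.
move: spanP Hinv un uk uS ut; set s' := sem span_prog s; clearbody s' => spanP Hinv un uk uS ut.
have [kB|kB] := leqP k #|B|; last first.
  rewrite record_prog_skip; last by rewrite ut cardSel uk; lia.
  case: Hinv => h1 h2; split=> // p' q' /orP[|/andP[/eqP-> /eqP->]]; first exact: h2.
  by rewrite leqNgt kB.
have [es [st ues ses [tS lS] lenle]] := spanP kB.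
have ck : #|Sel| = k by rewrite cardSel; lia.
have [c|c] := boolP ((nmem s' 0 1 <= nmem s' vTot 0)%N &&
    ((nmem s' vHave 0 == 0%N) || (rmem s' rLen 0 <= rmem s' rBestLen 0))).
  have [oG h26 h9] := record_progP un uS ues ses st c.
  split; first by right; exists Sel, (edge_set es); split=> //; rewrite ?ck // h9.
  move=> p' q' Qpq kB'; rewrite h26 h9; split=> // S E tSE cS pS qS SB.
  case/orP: Qpq => [Qpq|/andP[/eqP ep /eqP eq_]]; last first.
    by rewrite ep eq_ in pS qS SB; apply: lenle cS pS qS SB.
  case: Hinv => _ /(_ _ _ Qpq kB')[have0 /(_ S E tSE cS pS qS SB)].
  by apply: le_trans; case/andP: c => _; rewrite (negPf have0).
rewrite record_prog_skip //; case: Hinv => h1 h2; split=> // p' q' /orP[|/andP[/eqP-> /eqP->]].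
  exact: h2.
move: c; rewrite uk ut ck leqnn /= negb_or -ltNge => /andP[have0 lt9] _; split=> // S E tSE cS pS qS SB.
by apply: le_trans (ltW lt9) _; apply: lenle cS pS qS SB.
Qed.

Lemma k_tree_progP s : nmem s 0 0 = n -> nmem s 0 1 = k -> nmem s vM 0 = m -> nmem s vHave 0 = 0%N ->
    (forall u : 'I_n, pt s u = P u) ->
  best_inv k P (fun _ _ => true) (sem (PFor vP (PFor vQ pair_of_centers_prog)) s).
Proof.
move=> sn sk sm sh sP.
apply: (@eq_best_inv (fun p _ => p < nmem s 0 0)%N); first by move=> p q; rewrite sn ltn_ord.
apply: (sem_for (Inv := fun j t => best_inv k P (fun p _ => p < j)%N t)) => //.
  by split=> //; left.
move=> j t jn tj fr fr' IH.
apply: (@best_inv_eq _ (sem (PFor vQ pair_of_centers_prog) t)) => //.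
  by case=> [|[|[|[|[|a]]]]].
apply: (@eq_best_inv (fun p q => (p < j)%N || (nat_of_ord p == j) && (q < nmem t 0 0)%N)).
  by move=> p q; rewrite fr // sn ltn_ord andbT ltnS [RHS]leq_eqVlt orbC.
apply: (sem_for (Inv := fun i t' =>
  best_inv k P (fun p q => (p < j)%N || (nat_of_ord p == j) && (q < i)%N) t')) => //.
  apply: (@best_inv_eq _ t) => //; first by case=> [|[|[|[|[|a]]]]].
  by apply: eq_best_inv IH => p q; rewrite ltn0 andbF orbF.
move=> i t' in_ ti fr2 fr2' IH2.
apply: (@best_inv_eq _ (sem pair_of_centers_prog t')) => //; first by case=> [|[|[|[|[|a]]]]].
have jn' : (j < n)%N by rewrite -sn.
have in' : (i < n)%N by move: in_; rewrite fr // sn.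
have e1 : nmem t' 0 0 = n by rewrite fr2 // fr.
have e2 : nmem t' 0 1 = k by rewrite fr2 // fr.
have e3 : nmem t' vM 0 = m by rewrite fr2 // fr.
have e4 (u : 'I_n) : pt t' u = P u by rewrite -sP /pt !fr2' // !fr'.
have e5 : nmem t' vP 0 = Ordinal jn' by rewrite fr2.
have e6 : nmem t' vQ 0 = Ordinal in' by [].
apply: eq_best_inv (best_inv_step e1 e2 e3 e4 e5 e6 IH2) => p q.
rewrite -!val_eqE /= ltnS [(q <= i)%N]leq_eqVlt.
by case: (p < j)%N; case: (nat_of_ord p == j); case: (nat_of_ord q == i); case: (q < i)%N.
Qed.

(** Provides, for the vertex set [S] of an optimal tree, a pair of centers whose guarantee applies
    to it. *)
Lemma farthest_center (p : 'I_n) (S : {set 'I_n}) : p \in S ->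
  exists2 q, q \in S & S \subset centers_ball P p q.
Proof.
move=> pS; case: (@Order.TotalTheory.arg_maxP _ _ _ p (mem S) (fun q => l1_dist (P p) (P q)) pS).
move=> q qS qmax; exists q => //.
by apply/subsetP => u uS; rewrite inE; apply: qmax.
Qed.

End Main.

Theorem corollary1p4 (R : realType) :
  exists (prog : cmd) (time : nat -> nat) (C : R),
    poly_bounded time /\
    forall (n k : nat) (P : 'I_n -> R * R),
      (0 < k <= n)%N ->
      exists (t : nat) (s : memory R) (S : {set 'I_n}) (E : {set {set 'I_n}}),
        [/\ halts_in prog (input_memory k P) t s,
            (t <= time n)%N,
            output_graph s S E,
            is_tree S E /\ (k <= #|S|)%N &
            forall (S' : {set 'I_n}) (E' : {set {set 'I_n}}),
              min_rect_k_tree P k S' E' ->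
              rect_length P E <= C * k%:R `^ (4%:R^-1) * rect_length P E'].
Proof.
exists (compile k_tree_prog), (cost k_tree_prog), 96; split; first exact: poly_cost.
move=> n k P kn.
have [t tle ht] := compileP (input_memory k P) wf_k_tree_prog.
have [m0 mn km mk] := @grid_size_progP _ (input_memory k P) kn.
set s0 := input_memory k P in tle ht m0 mn km mk.
pose m := nmem (sem grid_size_prog s0) vM 0.
have /andP[k0 kn'] := kn.
have best : best_inv k P (fun _ _ => true) (sem k_tree_prog s0).
  rewrite /k_tree_prog 2!sem_seq.
  have g00 : nmem (sem grid_size_prog s0) 0 0 = n by rewrite nframe.
  have g01 : nmem (sem grid_size_prog s0) 0 1 = k by rewrite nframe.
  have gP (u : 'I_n) : pt (sem grid_size_prog s0) u = P u.
    by rewrite /pt !rframe //= valK; case: (P u).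
  apply: (@k_tree_progP R n k m P) => //.
case: best => b1 b2.
have n0 : (0 < n)%N by apply: leq_trans kn'.
pose p0 : 'I_n := Ordinal n0.
(* The ball of this pair contains all the points, hence at least [k], so some tree has been
   recorded. *)
have [q0 _ allB] := farthest_center P (in_setT p0).
have [|have0 _] := b2 p0 q0 isT.
  by apply: leq_trans kn' _; rewrite -[leqLHS]card_ord -cardsT subset_leq_card.
case: b1 => [h|[S [E [oG tS kS len]]]]; first by rewrite h in have0.
exists t, (sem k_tree_prog s0), S, E; split=> //.
move=> S' E' [tS' cS' _].
have [p pS'] : exists p, p \in S' by apply/set0Pn; rewrite -card_gt0 cS'.
have [q qS' SB] := farthest_center P pS'.
have [|_ bound] := b2 p q isT; first by rewrite -cS' subset_leq_card.
by rewrite len; apply: bound tS' cS' pS' qS' SB.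
Qed.
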